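(* Let $\mathcal{P}=(P,d\mu,d\sigma)$ be an $n$-dimensional system with $n\ge2$. For every $q\in[1,\frac{n}{n-1}]$ there exists a constant $C_{P,q}>0$ such that \[ \Big(\int_P u^q\,d\mu\Big)^{\frac1q}\le C_{P,q}\int_{\partial P}u\,d\sigma \] for every non-negative convex function $u:P\to[0,\infty]$.
   Context: An $n$-dimensional system is a triple $\mathcal{P}=(P,d\mu,d\sigma)$ where $P$ is a simple polytope in an $n$-dimensional real affine space $V$ (a compact subset with non-empty interior that is a finite intersection of closed half spaces, such that every vertex is the intersection of exactly $n$ facets), $d\mu$ is the restriction to $P$ of a translation-invariant measure on $V$ that is positive and finite on bounded non-empty open sets (i.e. a positive multiple of Lebesgue measure), and $d\sigma$ is a measure on the boundary $\partial P$ whose restriction to each facet is a positive multiple of the Lebesgue measure of the affine hyperplane spanned by that facet. *)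

(* Defs.v *)
From HB Require Import structures.
From mathcomp Require Import all_boot all_order all_algebra.
From mathcomp Require Import all_classical all_reals all_analysis.

Set Implicit Arguments.
Unset Strict Implicit.
Unset Printing Implicit Defensive.

Import Order.TTheory GRing.Theory Num.Theory.
Import numFieldNormedType.Exports.
Local Open Scope classical_set_scope.
Local Open Scope ring_scope.

Section Defs.
Variable R : realType.

Definition dotv (n : nat) (x a : 'rV[R]_n) : R := \sum_(j < n) x 0 j * a 0 j.

(* Lebesgue integral over R^n of a nonnegative extended-real function,
   computed as the iterated integral (Tonelli) of one-dimensional Lebesgue
   integrals: first coordinate outermost. *)
Fixpoint lebint (n : nat) : ('rV[R]_n -> \bar R) -> \bar R :=
  match n return ('rV[R]_n -> \bar R) -> \bar R with
  | 0 => fun f => f 0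
  | k.+1 => fun f =>
      (\int[@lebesgue_measure R]_(t in setT)
         lebint (fun y : 'rV[R]_k =>
           f (\row_(j < k.+1) match unlift ord0 j with
                              | Some j' => y 0%R j'
                              | None => (t : R)
                              end)))%E
  end.

Definition polyh (n m : nat) (a : 'I_m -> 'rV[R]_n) (b : 'I_m -> R) :
  set 'rV[R]_n := [set x | forall i, dotv x (a i) <= b i].

Definition face_i (n m : nat) (a : 'I_m -> 'rV[R]_n) (b : 'I_m -> R)
  (i : 'I_m) : set 'rV[R]_n :=
  [set x | polyh a b x /\ dotv x (a i) = b i].

Definition affdim_ge (n d : nat) (F : set 'rV[R]_n) : Prop :=
  exists p : 'I_d.+1 -> 'rV[R]_n, (forall k, F (p k)) /\
    \rank (\matrix_(k < d) (p (lift ord0 k) - p ord0)) = d.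

Definition extreme_point (n : nat) (P : set 'rV[R]_n) (v : 'rV[R]_n) : Prop :=
  P v /\ forall x y, P x -> P y -> v = 2^-1 *: (x + y) -> x = y.

(* (a, b) is an irredundant H-representation of an n-dimensional simple
   polytope P in R^n, whose facets are exactly the face_i a b i. *)
Definition simple_polytope_rep (n m : nat) (a : 'I_m -> 'rV[R]_n)
  (b : 'I_m -> R) : Prop :=
  (forall i, a i != 0) /\ [/\
      compact (polyh a b),
      (interior (polyh a b) !=set0),
      (forall i, affdim_ge n.-1 (face_i a b i)),
      (forall i j, face_i a b i = face_i a b j -> i = j) &
      (forall v, extreme_point (polyh a b) v ->
         #|[set i : 'I_m | dotv v (a i) == b i]| = n)].

Definition hyperplane_param (n : nat) (a : 'rV[R]_n) (b : R)
  (o : 'rV[R]_n) (M : 'M[R]_(n.-1, n)) : Prop :=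
  row_free M /\
  forall x, dotv x a = b <-> exists y : 'rV[R]_(n.-1), x = o + y *m M.

Definition convex_on (n : nat) (P : set 'rV[R]_n) (u : 'rV[R]_n -> \bar R)
  : Prop :=
  forall x y (t : R), P x -> P y -> 0 <= t <= 1 ->
    (u (((1 - t) *: x + t *: y)%R) <= (1 - t)%:E * u x + t%:E * u y)%E.

Definition vol_int (n m : nat) (a : 'I_m -> 'rV[R]_n) (b : 'I_m -> R)
  (cmu : R) (f : 'rV[R]_n -> \bar R) : \bar R :=
  (cmu%:E * lebint (f \_ (polyh a b)))%E.

(* int_{dP} f dsigma, with dsigma restricted to the facet F_i equal to
   csig i times the Lebesgue measure of the hyperplane of F_i, transported by
   the affine parametrisation y |-> o i + y *m M i. *)
Definition bdry_int (n m : nat) (a : 'I_m -> 'rV[R]_n) (b : 'I_m -> R)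
  (csig : 'I_m -> R) (o : 'I_m -> 'rV[R]_n) (M : 'I_m -> 'M[R]_(n.-1, n))
  (f : 'rV[R]_n -> \bar R) : \bar R :=
  (\sum_(i < m) (csig i)%:E *
     lebint (fun y : 'rV[R]_(n.-1) => (f \_ (face_i a b i)) ((o i + y *m M i)%R)))%E.

End Defs.

(* Main.v *)
(* Let [u] be convex on the [n]-dimensional polytope [P].  For [x] in [P] and a
   direction [k], the line through [x] parallel to the [k]-th axis leaves [P]
   through two facets at points [z-] and [z+], and [u x <= u z- + u z+].  The
   right-hand side is at most [f_k x], the sum over the facets transversal to the
   [k]-th axis of [u] (cut off to the facet) at the projection of [x] along that
   axis; [f_k] does not depend on the [k]-th coordinate, and its integral over
   the others is at most a constant times the boundary integral of [u], by an
   affine change of variables on each facet.  Hence [u^q] is bounded on [P] by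
   the product of the [f_k^(q/n)] and of a power of the indicator of a box, and
   Finner's generalization of the Loomis-Whitney inequality concludes: the
   exponent of the box is [1 - (n-1)q/n], which is non-negative exactly when
   [q <= n/(n-1)].

   The exits lie in relatively open facets for all [x] off finitely many
   hyperplanes.  On an open facet either [u] is finite, hence lower
   semicontinuous, or it is infinite on a box and so is the boundary integral. *)
Require Import Defs.
From HB Require Import structures.
From mathcomp Require Import all_boot all_order all_algebra.
From mathcomp Require Import all_classical all_reals all_analysis.
From mathcomp Require Import measurable_realfun.
From mathcomp Require Import ring lra.

Set Implicit Arguments.
Unset Strict Implicit.
Unset Printing Implicit Defensive.

Import Order.TTheory GRing.Theory Num.Theory.
Import numFieldNormedType.Exports.
Local Open Scope classical_set_scope.
Local Open Scope ring_scope.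

(** * Monotonicity of iterated integrals *)

Section IntegralLe.
Context d (T : measurableType d) (R : realType).
Variable mu : {measure set T -> \bar R}.
Local Open Scope ereal_scope.

Import HBNNSimple.

(* For non-negative functions the integral is a supremum over the simple
   functions below, i.e. a lower integral when the function is not measurable,
   and a simple function may be set to 0 on a null set. *)
Lemma ge0_le_integral_off (A : set T) (f g : T -> \bar R) :
  measurable A -> mu A = 0 -> (forall x, 0 <= f x) -> (forall x, 0 <= g x) ->
  (forall x, ~ A x -> f x <= g x) -> \int[mu]_x f x <= \int[mu]_x g x.
Proof.
move=> mA A0 f0 g0 fg; rewrite !ge0_integralTE//.
apply: ge_ereal_sup => _ [h /= hf <-].
have mA' : measurable (~` A) by exact: measurableC.
have -> : sintegral mu h = sintegral mu (proj_nnsfun h mA').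
  have E : sintegral mu h = \int[mu]_x (h x)%:E.
    by rewrite integral_nnsfun// patch_setT.
  have mh : measurable_fun setT (fun x => (h x)%:E) by exact/measurable_EFinP.
  rewrite E (@ge0_negligible_integral _ _ _ mu setT A)//; last first.
    by move=> x _; rewrite lee_fin.
  rewrite setTD integral_nnsfun//; apply: eq_sintegral => x /=.
  by rewrite /patch /= /mindic indicE; case: ifP => _; rewrite ?mulr1 ?mulr0.
apply: ereal_sup_ubound; exists (proj_nnsfun h mA') => //= x.
rewrite /mindic indicE; case: (boolP (x \in ~` A)) => [|] xA.
  by rewrite mulr1 (le_trans (hf x))// fg//; move: xA; rewrite inE.
by rewrite mulr0.
Qed.

Lemma ge0_le_integral_nonmeas (f g : T -> \bar R) :
  (forall x, 0 <= f x) -> (forall x, f x <= g x) ->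
  \int[mu]_x f x <= \int[mu]_x g x.
Proof.
move=> f0 fg; apply: (@ge0_le_integral_off set0) => // x.
exact: le_trans (f0 x) (fg x).
Qed.

End IntegralLe.

Section Insert.
Variable R : realType.
Local Open Scope ereal_scope.

(** For [k = ord0] this is the row inside [lebint], so [lebintS] holds by computation. A general [k]
    singles out any coordinate, as projections along the axes require. *)
Definition insert (n : nat) (k : 'I_n.+1) (t : R) (y : 'rV[R]_n) : 'rV[R]_n.+1 :=
  \row_(j < n.+1) match unlift k j with Some j' => y 0%R j' | None => t end.

Local Notation cons := (insert ord0).

Lemma insert_at n (k : 'I_n.+1) t y : insert k t y 0%R k = t.
Proof. by rewrite mxE unlift_none. Qed.

Lemma insert_lift n (k : 'I_n.+1) t y j : insert k t y 0%R (lift k j) = y 0%R j.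
Proof. by rewrite mxE liftK. Qed.

Lemma rowP_lift n (k : 'I_n.+1) (x y : 'rV[R]_n.+1) :
  x 0%R k = y 0%R k -> (forall j, x 0%R (lift k j) = y 0%R (lift k j)) -> x = y.
Proof. by move=> h0 h; apply/rowP => j; case: (unliftP k j) => [j'|] ->. Qed.

Lemma insert_lift_cons n (k : 'I_n.+1) t s y :
  insert (lift ord0 k) t (cons s y) = cons s (insert k t y).
Proof.
apply: (rowP_lift (k := ord0)) => [|j].
  rewrite insert_at.
  have -> : ord0 = lift (lift ord0 k) ord0 by apply: val_inj.
  by rewrite insert_lift insert_at.
rewrite insert_lift; case: (unliftP k j) => [j'|] ->; last by rewrite !insert_at.
rewrite insert_lift.
have -> : lift ord0 (lift k j') = lift (lift ord0 k) (lift ord0 j').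
  by apply: val_inj; rewrite /= /bump /= !add1n !ltnS; case: (_ <= _)%N.
by rewrite !insert_lift.
Qed.

Lemma lebintS n (f : 'rV[R]_n.+1 -> \bar R) :
  lebint f = \int[@lebesgue_measure R]_t lebint (fun y => f (cons t y)).
Proof. by []. Qed.

Lemma lebint_ge0 n (f : 'rV[R]_n -> \bar R) :
  (forall x, 0 <= f x) -> 0 <= lebint f.
Proof.
elim: n f => [|n IH] f f0; first exact: f0.
by rewrite lebintS; apply: integral_ge0 => t _; exact: IH.
Qed.

Lemma dotv_insert n (k : 'I_n.+1) t y (a : 'rV[R]_n.+1) :
  dotv (insert k t y) a = (t * a 0%R k + dotv y (\row_j a 0%R (lift k j)))%R.
Proof.
rewrite /dotv (bigD1_ord k)//= insert_at; congr +%R.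
by apply: eq_bigr => j _; rewrite insert_lift mxE.
Qed.

Lemma dotvDl n (x y a : 'rV[R]_n) : dotv (x + y)%R a = (dotv x a + dotv y a)%R.
Proof. by rewrite /dotv -big_split; apply: eq_bigr => j _; rewrite mxE mulrDl. Qed.

Lemma dotvZl n c (x a : 'rV[R]_n) : dotv (c *: x)%R a = (c * dotv x a)%R.
Proof. by rewrite /dotv mulr_sumr; apply: eq_bigr => j _; rewrite mxE mulrA. Qed.

Lemma dotvC n (x a : 'rV[R]_n) : dotv x a = dotv a x.
Proof. by rewrite /dotv; apply: eq_bigr => j _; rewrite mulrC. Qed.

Lemma dotv_delta n (k : 'I_n) (a : 'rV[R]_n) : dotv (delta_mx 0%R k) a = a 0%R k.
Proof.
rewrite /dotv (bigD1 k)//= big1 => [|j jk]; rewrite !mxE !eqxx ?mul1r ?addr0//.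
by rewrite (negbTE jk) mul0r.
Qed.

(** Finitely many hyperplanes are negligible, by induction on the dimension. Measurability is not
    assumed, since [u] is not known to be measurable. The condition on [al] and [be] excludes the
    equation 0 = 0 and allows empty hyperplanes. *)
Lemma le_lebint_off n (I : finType) (al : I -> 'rV[R]_n) (be : I -> R)
    (f g : 'rV[R]_n -> \bar R) :
  (forall i, al i != 0%R \/ be i != 0%R) ->
  (forall x, 0 <= f x) -> (forall x, 0 <= g x) ->
  (forall x, (forall i, dotv x (al i) <> be i) -> f x <= g x) ->
  lebint f <= lebint g.
Proof.
elim: n al be f g => [|n IH] al be f g ab f0 g0 fg.
  apply: fg => i; case: (ab i) => [|/eqP b0].
    by rewrite (_ : al i = 0%R) ?eqxx//; apply/rowP; case.
  by rewrite /dotv big_ord0 => /esym.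
rewrite !lebintS.
pose tl i := \row_j al i 0%R (lift ord0 j) : 'rV[R]_n.
(* Heights whose whole slice lies in one of the hyperplanes. At any other height each hyperplane
   cuts the slice in a proper hyperplane or not at all. *)
pose A := [set t | exists2 i, tl i = 0%R &
   al i 0%R ord0 != 0%R /\ t = (be i / al i 0%R ord0)%R].
have cA : countable A.
  apply: finite_set_countable.
  apply: (@sub_finite_set _ _ [set (be i / al i 0%R ord0)%R | i in [set: I]]).
    by move=> t [i _ [_ ->]]; exists i.
  exact: finite_image.
have nA : measurable A by exact: countable_measurable.
apply: (@ge0_le_integral_off _ _ _ (@lebesgue_measure R) A).
- exact: nA.
- exact: countable_lebesgue_measure0.
- by move=> t; apply: lebint_ge0.
- by move=> t; apply: lebint_ge0.
- move=> t At; apply: (IH tl (fun i => be i - t * al i 0%R ord0)%R) => //.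
    move=> i; have [ti|] := eqVneq (tl i) 0%R; last by left.
    right; rewrite subr_eq0; apply/eqP => E.
    have [a0|a0] := eqVneq (al i 0%R ord0) 0%R.
      case: (ab i); last by rewrite E a0 mulr0 eqxx.
      case/eqP; apply: (rowP_lift (k := ord0)); first by rewrite a0 mxE.
      by move=> j; move/rowP : ti => /(_ j); rewrite !mxE.
    by apply: At; exists i => //; split => //; rewrite E mulfK.
  move=> y hy; apply: fg => i; rewrite dotv_insert -/(tl i) => E.
  by apply: (hy i); rewrite -E addrC addKr.
Qed.

Lemma le_lebint n (f g : 'rV[R]_n -> \bar R) :
  (forall x, 0 <= f x) -> (forall x, f x <= g x) -> lebint f <= lebint g.
Proof.
move=> f0 fg.
apply: (@le_lebint_off _ void (fun _ => 0%R) (fun _ => 0%R)) => // x.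
exact: le_trans (f0 x) (fg x).
Qed.

Lemma eq_lebint n (f g : 'rV[R]_n -> \bar R) : f =1 g -> lebint f = lebint g.
Proof. by move=> /funext ->. Qed.

End Insert.

(** * Lower semicontinuous functions *)

Section PairContinuity.

Lemma pairf_continuous (X Y Z : topologicalType) (f : X -> Y) (g : X -> Z) :
  continuous f -> continuous g -> continuous (fun x => (f x, g x)).
Proof. by move=> fc gc x; apply: cvg_pair; [exact: fc|exact: gc]. Qed.

Lemma compf_continuous (X Y Z : topologicalType) (f : X -> Y) (g : Y -> Z) :
  continuous f -> continuous g -> continuous (fun x => g (f x)).
Proof. by move=> fc gc x; apply: continuous_comp; [exact: fc|exact: gc]. Qed.

Lemma cstf_continuous (X Y : topologicalType) (y : Y) :
  continuous (fun _ : X => y).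
Proof. by move=> x; exact: cvg_cst. Qed.

Lemma idf_continuous (X : topologicalType) : continuous (fun x : X => x).
Proof. by move=> x; exact: cvg_id. Qed.

Lemma fst_continuous (X Y : topologicalType) : continuous (@fst X Y).
Proof. by move=> x; exact: cvg_fst. Qed.

Lemma snd_continuous (X Y : topologicalType) : continuous (@snd X Y).
Proof. by move=> x; exact: cvg_snd. Qed.

End PairContinuity.

Section Continuity.
Variable R : realType.

Lemma rV_continuous (T : topologicalType) n (g : T -> 'rV[R]_n) :
  (forall j, continuous (fun x => g x 0 j)) -> continuous g.
Proof.
move=> gc x; apply/cvg_ballP => e e0.
have H : \forall y \near x, forall j, ball (g x 0 j) e (g y 0 j).
  by apply: filter_forall => j; have /cvg_ballP := gc j x; exact.
near=> y; split => // i j; rewrite (ord1 i).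
by have : forall j, ball (g x 0 j) e (g y 0 j) by near: y.
Unshelve. all: by end_near. Qed.

Lemma sum_continuous (T : topologicalType) (I : Type) (s : seq I)
    (g : I -> T -> R) :
  (forall i, continuous (g i)) -> continuous (fun x => \sum_(i <- s) g i x).
Proof.
move=> gc; elim: s => [|i s IH].
  by under eq_fun do rewrite big_nil; move=> x; exact: cvg_cst.
under eq_fun do rewrite big_cons.
by move=> x; apply: cvgD; [exact: gc|exact: IH].
Qed.

Lemma mulrc_continuous (T : topologicalType) (c : R) (g : T -> R) :
  continuous g -> continuous (fun x => g x * c).
Proof. by move=> gc x; apply: cvgM; [exact: gc|exact: cvg_cst]. Qed.

Lemma addrc_continuous (T : topologicalType) (c : R) (g : T -> R) :
  continuous g -> continuous (fun x => g x + c).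
Proof. by move=> gc x; apply: cvgD; [exact: gc|exact: cvg_cst]. Qed.

Lemma addf_continuous (T : topologicalType) (f g : T -> R) :
  continuous f -> continuous g -> continuous (fun x => f x + g x).
Proof. by move=> fc gc x; apply: cvgD; [exact: fc|exact: gc]. Qed.

Lemma insert_continuous n (k : 'I_n.+1) :
  continuous (fun p : R * 'rV[R]_n => insert k p.1 p.2).
Proof.
apply: rV_continuous => j.
case: (unliftP k j) => [j'|] ->; last first.
  by under eq_fun do rewrite insert_at; move=> p; exact: cvg_fst.
under eq_fun do rewrite insert_lift.
move=> p; apply: (@continuous_comp _ _ _ snd (fun y : 'rV[R]_n => y 0 j')).
  exact: cvg_snd.
exact: coord_continuous.
Qed.

Lemma dotv_continuous n (a : 'rV[R]_n) : continuous (fun x => dotv x a).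
Proof.
apply: sum_continuous => j; apply: mulrc_continuous; exact: coord_continuous.
Qed.

Lemma affine_continuous m n (N : 'M[R]_(m, n)) (v : 'rV[R]_n) :
  continuous (fun y : 'rV[R]_m => y *m N + v).
Proof.
apply: rV_continuous => j.
under eq_fun do rewrite mxE.
apply: addrc_continuous; under eq_fun do rewrite mxE.
apply: (@sum_continuous _ _ _ (fun i (y : 'rV[R]_m) => y 0 i * N i j)) => i.
by apply: mulrc_continuous; exact: coord_continuous.
Qed.

End Continuity.

Section Nlsc.
Variable R : realType.
Local Open Scope ereal_scope.

(* Non-negative lower semicontinuous functions stand in for the measurable
   ones: the class is stable under continuous reparametrizations, sections and,
   by Fatou's lemma, partial integrals. *)
Definition nlsc (X : topologicalType) (f : X -> \bar R) :=
  (forall x, 0 <= f x) /\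
  forall x (a : R), a%:E < f x -> \forall y \near x, a%:E < f y.

Lemma nlsc_lsc (X : topologicalType) (f : X -> \bar R) :
  nlsc f -> lower_semicontinuous f.
Proof. by move=> [_ fl] x a /fl fa; exists [set y | a%:E < f y]. Qed.

Lemma nlsc_open (X : topologicalType) (f : X -> \bar R) (a : R) :
  nlsc f -> open [set x | a%:E < f x].
Proof. by move=> /nlsc_lsc /lower_semicontinuousP; exact. Qed.

Lemma nlsc_comp (X Y : topologicalType) (g : X -> Y) (f : Y -> \bar R) :
  continuous g -> nlsc f -> nlsc (f \o g).
Proof.
move=> gc [f0 fl]; split=> [x|x a afx] /=; first exact: f0.
exact: gc (fl _ _ afx).
Qed.

Lemma nlsc_cst (X : topologicalType) (c : \bar R) :
  0 <= c -> nlsc (fun _ : X => c).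
Proof. by move=> c0; split=> // x a ac; exact: nearW. Qed.

Lemma nlsc0 (X : topologicalType) : nlsc (fun _ : X => 0).
Proof. exact: nlsc_cst. Qed.

Lemma nlsc_indic (X : topologicalType) (A : set X) :
  open A -> nlsc (fun x => (\1_A x)%:E : \bar R).
Proof.
move=> oA; split=> [x|x a]; first by rewrite lee_fin.
rewrite indicE; case: (boolP (x \in A)) => xA; last first.
  move=> a0; apply: nearW => y; apply: lt_le_trans a0 _.
  by rewrite lee_fin.
move=> a1; rewrite inE in xA; move: (open_nbhs_nbhs (conj oA xA)).
by apply: filterS => y Ay; rewrite indicE mem_set.
Qed.

Lemma nlscD (X : topologicalType) (f g : X -> \bar R) :
  nlsc f -> nlsc g -> nlsc (fun x => f x + g x).
Proof.
move=> [f0 fl] [g0 gl]; split=> [x|x a afg]; first exact: adde_ge0.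
have [b [c [bf cg abc]]] : exists b c : R,
   [/\ b%:E < f x, c%:E < g x & (a <= b + c)%R].
  move: afg (f0 x) (g0 x); case: (f x) => [r||]; case: (g x) => [s||] //.
  - rewrite -EFinD lte_fin => ars _ _; pose e := ((r + s - a) / 2)%R.
    exists (r - e)%R, (s - e)%R; rewrite !lte_fin /e.
    by split; lra.
  - move=> _ _ _; exists (r - 1)%R, (a - (r - 1))%R.
    by rewrite lte_fin ltry; split => //; lra.
  - move=> _ _ _; exists (a - (s - 1))%R, (s - 1)%R.
    by rewrite lte_fin ltry; split => //; lra.
  - by move=> _ _ _; exists a, 0%R; rewrite !ltry addr0.
near=> y.
have bfy : b%:E < f y by near: y; exact: fl.
have cgy : c%:E < g y by near: y; exact: gl.
apply: (@le_lt_trans _ _ (b%:E + c%:E)); first by rewrite -EFinD lee_fin.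
exact: lteD.
Unshelve. all: by end_near. Qed.

Lemma nlsc_sum (X : topologicalType) (I : Type) (s : seq I) (P : pred I)
    (f : I -> X -> \bar R) :
  (forall i, P i -> nlsc (f i)) -> nlsc (fun x => \sum_(i <- s | P i) f i x).
Proof.
move=> fl; elim: s => [|i s IH].
  by under eq_fun do rewrite big_nil; exact: nlsc0.
under eq_fun do rewrite big_cons; case: (boolP (P i)) => // Pi.
by apply: nlscD => //; exact: fl.
Qed.

Lemma nlscZ (X : topologicalType) (c : R) (f : X -> \bar R) :
  (0 <= c)%R -> nlsc f -> nlsc (fun x => c%:E * f x).
Proof.
rewrite le0r => /orP[/eqP ->|c0] [f0 fl].
  by under eq_fun do rewrite mul0e; exact: nlsc0.
split=> [x|x a]; first by rewrite mule_ge0// lee_fin ltW.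
by rewrite -lte_pdivrMl// -EFinM => /fl; apply: filterS => y;
  rewrite EFinM lte_pdivrMl.
Qed.

Lemma nlsc_measurable (f : R -> \bar R) : nlsc f ->
  measurable_fun [set: measurableTypeR R] f.
Proof. by move=> /nlsc_lsc; exact: lower_semicontinuous_measurable. Qed.

(** [U] is the countable union of the rational rectangles it contains. This links the topology of
    the plane to the product sigma-algebra of Tonelli's theorem. *)
Lemma open_measurable2 (U : set (R * R)) : open U ->
  measurable (U : set (measurableTypeR R * measurableTypeR R)%type).
Proof.
move=> oU.
pose rect (p r q s : rat) : set (R * R) :=
  [set` `]ratr p, ratr r[%R] `*` [set` `]ratr q, ratr s[%R].
have -> : U = \bigcup_p \bigcup_r \bigcup_q \bigcup_s
    (if `[< rect p r q s `<=` U >] then rect p r q s else set0).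
  apply/seteqP; split => [[x y] Uxy|z [p _ [r _ [q _ [s _]]]]]; last first.
    by case: asboolP => // rU /rU.
  have /nbhs_ballP[e /= e0 eU] : nbhs (x, y) U by exact: open_nbhs_nbhs.
  have rat_between (u v : R) : (u < v)%R ->
      exists w : rat, (u < ratr w)%R /\ (ratr w < v)%R.
    by move=> /rat_in_itvoo[w]; rewrite inE /= => /andP[]; exists w.
  have [p [p1 p2]] : exists w : rat, (x - e < ratr w)%R /\ (ratr w < x)%R.
    by apply: rat_between; lra.
  have [r [r1 r2]] : exists w : rat, (x < ratr w)%R /\ (ratr w < x + e)%R.
    by apply: rat_between; lra.
  have [q [q1 q2]] : exists w : rat, (y - e < ratr w)%R /\ (ratr w < y)%R.
    by apply: rat_between; lra.
  have [s [s1 s2]] : exists w : rat, (y < ratr w)%R /\ (ratr w < y + e)%R.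
    by apply: rat_between; lra.
  exists p => //; exists r => //; exists q => //; exists s => //.
  case: asboolP => [_|].
    by split => /=; rewrite in_itv/= ?p2 ?r1 ?q2 ?s1.
  case=> -[x' y'] [/=]; rewrite !in_itv/= => /andP[h1 h2] /andP[h3 h4].
  by apply: eU; split; rewrite /ball /= ltr_norml; apply/andP; split; lra.
apply: bigcupT_measurable_rat => p; apply: bigcupT_measurable_rat => r.
apply: bigcupT_measurable_rat => q; apply: bigcupT_measurable_rat => s.
case: asboolP => // _; apply: measurableX; exact: measurable_itv.
Qed.

Lemma nlsc_measurable2 (f : R * R -> \bar R) : nlsc f ->
  measurable_fun [set: (measurableTypeR R * measurableTypeR R)%type] f.
Proof.
move=> fl; apply: (measurability _ (ErealGenOInfty.measurableE R)).
move=> /= _ [_ [a ->]] <-; apply: measurableI => //; apply: open_measurable2.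
by rewrite preimage_itvoy; exact: nlsc_open.
Qed.

Lemma nlsc_section (X Y : topologicalType) (f : X * Y -> \bar R) x :
  nlsc f -> nlsc (fun y => f (x, y)).
Proof.
by apply: nlsc_comp; apply: pairf_continuous;
  [exact: cstf_continuous|exact: idf_continuous].
Qed.

Lemma lee_of_lt_fin (l s : \bar R) :
  (forall a : R, a%:E < l -> a%:E <= s) -> l <= s.
Proof.
case: l => [r| |] h; last exact: leNye.
  by apply/lee_subgt0Pr => e e0; apply: h; rewrite lte_fin; lra.
rewrite leye_eq; case: s h => [s|//|] h.
  by have := h (s + 1)%R (ltry _); rewrite lee_fin; lra.
by have := h 0%R (ltry _).
Qed.

Lemma le_limn_einf (l : \bar R) (u : (\bar R)^nat) :
  (forall a : R, a%:E < l -> \forall k \near \oo, a%:E < u k) ->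
  l <= limn_einf u.
Proof.
move=> lu; rewrite limn_einf_lim (cvg_lim _ (@cvg_einfs_sup _ u))//.
apply: lee_of_lt_fin => a /lu[k _ ku].
apply: (@le_trans _ _ (einfs u k)); last by apply: ereal_sup_ubound; exists k.
by apply: le_ereal_inf_tmp => _ [i /= ki <-]; exact/ltW/ku.
Qed.

Lemma limn_einf_le (u : (\bar R)^nat) (c : \bar R) :
  (forall k, u k <= c) -> limn_einf u <= c.
Proof.
move=> uc; rewrite limn_einf_lim (cvg_lim _ (@cvg_einfs_sup _ u))//.
apply: ge_ereal_sup => _ [k _ <-].
by apply: le_trans (uc k); apply: ereal_inf_lbound; exists k => /=.
Qed.

(** If the conclusion failed at [x], points [y k] tending to [x] would have integrals at most [a].
    Since [f (x, t)] is at most the lower limit of [f (y k, t)], Fatou's lemma would bound the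
    integral at [x] by [a] too. *)
Lemma nlsc_integral (X : pseudoMetricType R) (f : X * R -> \bar R) : nlsc f ->
  nlsc (fun x => \int[@lebesgue_measure R]_t f (x, t)).
Proof.
move=> fl; split=> [x|x a aF]; first by apply: integral_ge0 => t _; case: fl.
apply: contrapT => nF.
have xk k : exists y : X, ball x k.+1%:R^-1 y /\
    \int[@lebesgue_measure R]_t f (y, t) <= a%:E.
  apply: contrapT => nE; apply: nF; apply/nbhs_ballP.
  exists (k.+1%:R^-1)%R => /=; first by rewrite invr_gt0.
  by move=> y xy; rewrite ltNge; apply/negP => Fy; apply: nE; exists y.
have /choice[y yP] := xk.
have yx : y @ \oo --> x.
  apply/cvg_ballP => e e0; near=> k.
  apply: (@le_ball _ _ _ k.+1%:R^-1%R); last by case: (yP k).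
  by apply: ltW; near: k; exact: (near_infty_natSinv_lt (PosNum e0)).
have : \int[@lebesgue_measure R]_t f (x, t) <= a%:E; last by rewrite leNgt aF.
apply: (@le_trans _ _ (\int[@lebesgue_measure R]_t
   limn_einf (fun k => f (y k, t)))).
  apply: ge0_le_integral_nonmeas => t; first by case: fl.
  apply: le_limn_einf => b bf; have [_ /(_ _ _ bf) H] := fl.
  have ct : (fun _ : nat => t) @ \oo --> (t : R) by exact: cvg_cst.
  have : (fun k => (y k, t)) @ \oo --> (x, t) by exact: (cvg_pair yx ct).
  by move=> /(_ _ H).
have mf k : measurable_fun [set: measurableTypeR R] (fun t => f (y k, t)).
  by apply: nlsc_measurable; exact: nlsc_section.
apply: le_trans (fatou _ measurableT mf _) _; first by move=> k t _; case: fl.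
by apply: limn_einf_le => k; case: (yP k).
Unshelve. all: by end_near. Qed.

(** The coordinates outside [s] are frozen at 0 rather than removed, so that all factors in Finner's
    inequality live on the same space. *)
Fixpoint plebint (n : nat) : ('I_n -> bool) -> ('rV[R]_n -> \bar R) -> \bar R :=
  match n with
  | 0 => fun _ f => f 0%R
  | k.+1 => fun s f =>
      if s ord0 then \int[@lebesgue_measure R]_t
        plebint (fun j => s (lift ord0 j)) (fun y => f (insert ord0 t y))
      else plebint (fun j => s (lift ord0 j)) (fun y => f (insert ord0 0%R y))
  end.

Lemma plebintS n (s : 'I_n.+1 -> bool) (f : 'rV[R]_n.+1 -> \bar R) :
  plebint s f = if s ord0 then \int[@lebesgue_measure R]_t
        plebint (fun j => s (lift ord0 j)) (fun y => f (insert ord0 t y))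
      else plebint (fun j => s (lift ord0 j)) (fun y => f (insert ord0 0%R y)).
Proof. by []. Qed.

Lemma plebint_ge0 n (s : 'I_n -> bool) (f : 'rV[R]_n -> \bar R) :
  (forall x, 0 <= f x) -> 0 <= plebint s f.
Proof.
elim: n s f => [|n IH] s f f0; first exact: f0.
rewrite plebintS; case: ifP => _; last exact: IH.
by apply: integral_ge0 => t _; exact: IH.
Qed.

Lemma nlsc_plebint n (X : pseudoMetricType R) (s : 'I_n -> bool)
    (f : X * 'rV[R]_n -> \bar R) :
  nlsc f -> nlsc (fun x => plebint s (fun y => f (x, y))).
Proof.
elim: n X s f => [|n IH] X s f fl.
  change (nlsc (f \o (fun x : X => (x, 0%R : 'rV[R]_0)))).
  apply: nlsc_comp fl.
  by apply: pairf_continuous; [exact: idf_continuous|exact: cstf_continuous].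
pose h (p : (X * R) * 'rV[R]_n) := f (p.1.1, insert ord0 p.1.2 p.2).
have hl : nlsc h.
  change (nlsc (f \o (fun p : (X * R) * 'rV[R]_n =>
    (p.1.1, insert ord0 p.1.2 p.2)))).
  apply: nlsc_comp fl.
  apply: pairf_continuous.
    by apply: (@compf_continuous _ _ _ fst fst); exact: fst_continuous.
  apply: (@compf_continuous _ _ _ (fun p : (X * R) * 'rV[R]_n => (p.1.2, p.2))
    (fun p => insert ord0 p.1 p.2)); last exact: insert_continuous.
  apply: pairf_continuous; last exact: snd_continuous.
  by apply: (@compf_continuous _ _ _ fst snd);
    [exact: fst_continuous|exact: snd_continuous].
have hI := IH _ (fun j => s (lift ord0 j)) _ hl.
case: (boolP (s ord0)) => s0.
  by under eq_fun do rewrite plebintS s0; exact: (nlsc_integral hI).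
under eq_fun do rewrite plebintS (negbTE s0).
apply: (nlsc_comp (g := fun x : X => (x, 0%R)) _ hI).
by apply: pairf_continuous; [exact: idf_continuous|exact: cstf_continuous].
Qed.

Lemma plebintT n (f : 'rV[R]_n -> \bar R) : plebint xpredT f = lebint f.
Proof.
elim: n f => [//|n IH] f; rewrite plebintS lebintS.
by apply: eq_integral => t _; exact: IH.
Qed.

Lemma nlsc_lebint n (X : pseudoMetricType R) (f : X * 'rV[R]_n -> \bar R) :
  nlsc f -> nlsc (fun x => lebint (fun y => f (x, y))).
Proof.
by move=> /(nlsc_plebint xpredT); under eq_fun do rewrite plebintT.
Qed.

Lemma nlsc_lebint_insert n (k : 'I_n.+1) (f : 'rV[R]_n.+1 -> \bar R) :
  nlsc f -> nlsc (fun t => lebint (fun y => f (insert k t y))).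
Proof.
move=> fl; apply: (@nlsc_lebint _ _ (fun p => f (insert k p.1 p.2))).
exact: (nlsc_comp (@insert_continuous R n k) fl).
Qed.

Lemma nlsc_insert n (k : 'I_n.+1) t (f : 'rV[R]_n.+1 -> \bar R) :
  nlsc f -> nlsc (fun y => f (insert k t y)).
Proof.
move=> fl; apply: (@nlsc_section _ _ (fun p => f (insert k p.1 p.2))).
exact: (nlsc_comp (@insert_continuous R n k) fl).
Qed.

(** Additivity needs measurable integrands at every level of the iteration; lower semicontinuity
    passes to the partial integrals and provides it. *)
Lemma lebintD n (f g : 'rV[R]_n -> \bar R) : nlsc f -> nlsc g ->
  lebint (fun x => f x + g x) = lebint f + lebint g.
Proof.
elim: n f g => [//|n IH] f g fl gl; rewrite !lebintS -ge0_integralD//.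
- by apply: eq_integral => t _; apply: IH; exact: nlsc_insert.
- by move=> t _; apply: lebint_ge0 => y; case: fl.
- by apply: nlsc_measurable; exact: nlsc_lebint_insert.
- by move=> t _; apply: lebint_ge0 => y; case: gl.
- by apply: nlsc_measurable; exact: nlsc_lebint_insert.
Qed.

Lemma lebintZ n (c : R) (f : 'rV[R]_n -> \bar R) : (0 <= c)%R -> nlsc f ->
  lebint (fun x => c%:E * f x) = c%:E * lebint f.
Proof.
move=> c0; elim: n f => [//|n IH] f fl.
rewrite !lebintS -ge0_integralZl ?lee_fin//.
- by apply: eq_integral => t _; apply: IH; exact: nlsc_insert.
- by apply: nlsc_measurable; exact: nlsc_lebint_insert.
- by move=> t _; apply: lebint_ge0 => y; case: fl.
Qed.

Lemma lebint0 n : lebint (fun _ : 'rV[R]_n => 0 : \bar R) = 0.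
Proof.
elim: n => [//|n IH]; rewrite lebintS.
by under eq_integral do rewrite IH; rewrite integral0.
Qed.

Lemma lebint_sum n (I : Type) (s : seq I) (P : pred I)
    (f : I -> 'rV[R]_n -> \bar R) : (forall i, P i -> nlsc (f i)) ->
  lebint (fun x => \sum_(i <- s | P i) f i x) =
  \sum_(i <- s | P i) lebint (f i).
Proof.
move=> fl; elim: s => [|i s IH].
  by under eq_fun do rewrite big_nil; rewrite lebint0 big_nil.
rewrite big_cons; under eq_fun do rewrite big_cons.
case: (boolP (P i)) => // Pi; rewrite lebintD ?IH//; first exact: fl.
exact: nlsc_sum.
Qed.

End Nlsc.

(** * Finner's inequality *)

Section AMGM.
Variable R : realType.

Lemma weighted_AMGM (J : finType) (P : pred J) (th x : J -> R) :
  (forall j, P j -> 0 <= th j) -> \sum_(j | P j) th j = 1 ->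
  (forall j, P j -> 0 < x j) ->
  \prod_(j | P j) (x j `^ th j) <= \sum_(j | P j) th j * x j.
Proof.
move=> th0 th1 x0; set A := leRHS.
have A0 : 0 < A.
  rewrite lt_neqAle eq_sym sumr_ge0 ?andbT; last first.
    by move=> j Pj; rewrite mulr_ge0 ?th0// ltW// x0.
  apply/eqP => /psumr_eq0P h; move: th1; rewrite big1 => [/esym/eqP|j Pj].
    by rewrite oner_eq0.
  have := h (fun j Pj => mulr_ge0 (th0 j Pj) (ltW (x0 j Pj))) j Pj.
  by move/eqP; rewrite mulf_eq0 (gt_eqF (x0 _ Pj)) orbF => /eqP.
have -> : \prod_(j | P j) (x j `^ th j) =
    expR (\sum_(j | P j) th j * ln (x j)).
  rewrite expR_sum; apply: eq_bigr => j Pj.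
  by rewrite /powR gt_eqF ?x0.
rewrite -[leRHS](lnK (A0 : A \is Num.pos)) ler_expR.
(* [ln] lies below its tangent at the weighted mean [A]. The weighted sum of the linear corrections
   vanishes by the definition of [A]. *)
have lnx j : P j -> th j * ln (x j) <= th j * ln A + (th j * x j / A - th j).
  move=> Pj; have -> : x j = A * (x j / A) by rewrite mulrC divfK ?gt_eqF.
  rewrite lnM ?posrE ?divr_gt0 ?x0// mulrDr lerD2l.
  have -> : th j * (A * (x j / A)) / A - th j = th j * (x j / A - 1).
    by field; rewrite gt_eqF.
  apply: ler_wpM2l; first exact: th0.
  have {1}-> : x j / A = 1 + (x j / A - 1) by rewrite addrC subrK.
  by rewrite le_ln1Dx// ltrBrDl subrr divr_gt0// x0.
apply: (le_trans (ler_sum _ lnx)).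
rewrite big_split/= sumrB -!mulr_suml -/A th1 divff ?gt_eqF//.
by rewrite subrr addr0 mul1r.
Qed.

End AMGM.

Section Finner.
Variable R : realType.

(** Makes a function depend on the coordinates in [s] only, with the same value 0 at the others as
    in [plebint]. *)
Definition mask (n : nat) (s : 'I_n -> bool) (x : 'rV[R]_n) : 'rV[R]_n :=
  \row_j if s j then x 0 j else 0.

Lemma mask_insert n (s : 'I_n.+1 -> bool) t (y : 'rV[R]_n) :
  mask s (insert ord0 t y) =
  insert ord0 (if s ord0 then t else 0) (mask (fun j => s (lift ord0 j)) y).
Proof.
apply: (rowP_lift (k := ord0)) => [|j].
  by rewrite mxE !insert_at.
by rewrite mxE !insert_lift mxE.
Qed.

Local Open Scope ereal_scope.

Lemma lee_prod (I : Type) (r : seq I) (P : pred I) (f g : I -> \bar R) :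
  (forall i, P i -> 0 <= f i <= g i) ->
  \prod_(i <- r | P i) f i <= \prod_(i <- r | P i) g i.
Proof.
move=> fg; suff /andP[] : 0 <= \prod_(i <- r | P i) f i <= \prod_(i <- r | P i) g i by [].
elim/big_ind2 : _ => //; first by rewrite lexx lee01.
move=> x1 x2 y1 y2 /andP[x0 x12] /andP[y0 y12].
by rewrite mule_ge0// lee_pmul.
Qed.

Lemma poweR_prod_le (J : finType) (th c : J -> R) (x : J -> \bar R) :
  (forall j, 0 <= th j)%R -> (forall j, 0 < c j)%R -> (forall j, 0 <= x j) ->
  (forall j, (0 < th j)%R -> x j <= (c j)%:E) ->
  \prod_j (x j `^ th j) <= (\prod_j (c j `^ th j)%R)%:E.
Proof.
move=> th0 c0 x0 xc; rewrite -prodEFin; apply: lee_prod => j _.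
rewrite poweR_ge0/= -poweR_EFin.
have [tj|tj] := eqVneq (th j) 0%R; first by rewrite tj !poweRe0.
apply: gt0_ler_poweR => //.
- by rewrite in_itv/= x0 leey.
- by rewrite in_itv/= lee_fin ltW ?c0 ?leey.
- by apply: xc; rewrite lt_neqAle eq_sym tj th0.
Qed.

(* The coordinate 0 is integrated last: the induction hypothesis bounds the
   inner integral by a product of powers, which the weighted AM-GM inequality
   turns into a sum. *)
Theorem finner n (J : finType) (s : J -> 'I_n -> bool) (th c : J -> R)
    (f : J -> 'rV[R]_n -> \bar R) :
  (forall j, 0 <= th j)%R -> (forall j, 0 < c j)%R ->
  (forall i, \sum_(j | s j i) th j = 1)%R ->
  (forall j, nlsc (f j)) ->
  (forall j, (0 < th j)%R -> plebint (s j) (f j) <= (c j)%:E) ->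
  lebint (fun x => \prod_j (f j (mask (s j) x) `^ th j)) <=
  (\prod_j (c j `^ th j)%R)%:E.
Proof.
elim: n s c f => [|n IH] s c f th0 c0 th1 fl fc.
  apply: poweR_prod_le => // j; first by case: (fl j).
  move=> tj; have -> : mask (s j) 0%R = 0%R by apply/rowP; case.
  exact: (fc j tj).
rewrite lebintS.
pose s' j (i : 'I_n) := s j (lift ord0 i).
pose F j t y := f j (insert ord0 (if s j ord0 then t else 0%R) y).
pose C j t := plebint (s' j) (F j t).
have Fl j t : nlsc (F j t) by exact: nlsc_insert.
have C0 j t : 0 <= C j t by apply: plebint_ge0 => y; case: (Fl j t).
pose K := (\prod_j (c j `^ th j))%R.
have K0 : (0 < K)%R by apply: prodr_gt0 => j _; exact: powR_gt0.
have Cint j : s j ord0 -> (0 < th j)%R ->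
    \int[@lebesgue_measure R]_t C j t <= (c j)%:E.
  move=> sj tj; apply: le_trans (fc j tj); rewrite plebintS sj /C /F sj.
  exact: lexx.
have Cle j t : ~~ s j ord0 -> (0 < th j)%R -> C j t <= (c j)%:E.
  move=> sj tj; apply: le_trans (fc j tj); rewrite plebintS (negbTE sj).
  by rewrite /C /F (negbTE sj); exact: lexx.
(* The coefficients come from AM-GM for the ratios [C j t / c j] with weights [th j], which add up
   to 1 over the [j] with [s j ord0]. As [C j] integrates to at most [c j] when [th j] is positive,
   the final sum is at most [K]. *)
pose w j := (K * th j / c j)%R.
have w0 j : (0 <= w j)%R.
  by rewrite /w divr_ge0// ?mulr_ge0// ltW.
have inner t : lebint (fun y => \prod_j (F j t (mask (s' j) y) `^ th j)) <=
    \sum_(j | s j ord0) (w j)%:E * C j t.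
  have wC0 j : 0 <= (w j)%:E * C j t by rewrite mule_ge0// lee_fin.
  have [Coo|Cfin] := pselect (exists j, [/\ s j ord0, (0 < th j)%R &
      C j t = +oo]).
    have [j [sj tj Cj]] := Coo.
    rewrite (bigD1 j)//= Cj gt0_muley ?addye ?leey//.
      by rewrite -ltNye (lt_le_trans (ltNyr 0))// sume_ge0.
    by rewrite lte_fin /w divr_gt0// mulr_gt0.
  have Cf j : s j ord0 -> (0 < th j)%R -> C j t \is a fin_num.
    move=> sj tj; rewrite ge0_fin_numE// ltey; apply/eqP => Cj.
    by apply: Cfin; exists j.
  (* Some [C j t] may vanish, whereas the induction hypothesis and AM-GM ask for positive bounds.
     Adding [e'] to each costs [L * e'], which is at most [e]. *)
  apply/lee_addgt0Pr => e e0.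
  pose L := (\sum_(j | s j ord0) w j)%R.
  have L0 : (0 <= L)%R by apply: sumr_ge0.
  pose e' := (e / (L + 1))%R.
  have e'0 : (0 < e')%R by rewrite divr_gt0// ltr_wpDl.
  pose d j := if s j ord0 then (fine (C j t) + e')%R else c j.
  have d0 j : (0 < d j)%R.
    by rewrite /d; case: ifP => // _; rewrite ltr_wpDl// fine_ge0.
  apply: (@le_trans _ _ (\prod_j (d j `^ th j)%R)%:E).
    apply: (IH s' d (fun j => F j t)) => //; first by move=> i; exact: th1.
    move=> j tj; rewrite -/(C j t) /d; case: ifP => sj.
      by rewrite EFinD fineK ?Cf// leeDl// lee_fin ltW.
    by apply: Cle; rewrite ?sj.
  apply: (@le_trans _ _ (\sum_(j | s j ord0) w j * (fine (C j t) + e'))%R%:E).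
    rewrite lee_fin.
    have -> : (\prod_j d j `^ th j = K *
        \prod_(j | s j ord0) (((fine (C j t) + e') / c j) `^ th j))%R.
      rewrite /K (bigID (fun j => s j ord0))/= [in RHS](bigID (fun j => s j ord0))/=.
      rewrite mulrAC -big_split/=; congr (_ * _)%R; apply: eq_bigr => j sj.
        have x0 : (0 <= fine (C j t) + e')%R by rewrite addr_ge0 ?fine_ge0// ltW.
        rewrite /d sj -powRM ?(ltW (c0 j)) ?divr_ge0 ?(ltW (c0 j))//.
        by rewrite mulrC divfK ?gt_eqF.
      by rewrite /d (negbTE sj).
    have -> : (\sum_(j | s j ord0) w j * (fine (C j t) + e') = K *
        \sum_(j | s j ord0) th j * ((fine (C j t) + e') / c j))%R.
      rewrite mulr_sumr; apply: eq_bigr => j _; rewrite /w; field.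
      by rewrite gt_eqF.
    apply: ler_wpM2l; first exact: ltW.
    apply: weighted_AMGM => // j sj.
    by rewrite divr_gt0// ltr_wpDl// fine_ge0.
  have -> : (\sum_(j | s j ord0) w j * (fine (C j t) + e') =
      \sum_(j | s j ord0) w j * fine (C j t) + L * e')%R.
    by under eq_bigr do rewrite mulrDr; rewrite big_split/= mulr_suml.
  rewrite EFinD; apply: leeD.
    rewrite -sumEFin; apply: lee_sum => j sj; rewrite EFinM.
    have [tj|tj] := eqVneq (th j) 0%R; first by rewrite /w tj mulr0 mul0r !mul0e.
    by rewrite fineK// Cf// lt_neqAle eq_sym tj th0.
  rewrite lee_fin /e' mulrA ler_pdivrMr ?ltr_wpDl//.
  by nra.
have Cl j : nlsc (fun t => C j t).
  rewrite /C; case: (boolP (s j ord0)) => sj; last first.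
    have -> : (fun t => plebint (s' j) (F j t)) = fun _ => C j 0%R.
      by apply/funext => t; rewrite /C /F (negbTE sj).
    exact: nlsc_cst.
  apply: (@nlsc_plebint _ _ _ _ (fun p => F j p.1 p.2)); rewrite /F sj.
  exact: (nlsc_comp (@insert_continuous R n ord0) (fl j)).
apply: (@le_trans _ _ (\int[@lebesgue_measure R]_t
    \sum_(j | s j ord0) (w j)%:E * C j t)).
  apply: ge0_le_integral_nonmeas => t.
    by apply: lebint_ge0 => y; apply: prode_ge0 => j _; exact: poweR_ge0.
  apply: le_trans (inner t); rewrite le_eqVlt; apply/orP; left; apply/eqP.
  apply: eq_lebint => y; apply: eq_bigr => j _; rewrite mask_insert.
  by rewrite /F.
have -> : \int[@lebesgue_measure R]_t (\sum_(j | s j ord0) (w j)%:E * C j t) =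
    \sum_(j | s j ord0) (w j)%:E * \int[@lebesgue_measure R]_t C j t.
  under eq_integral do rewrite -big_filter.
  rewrite ge0_integral_sum//; last 2 first.
  - by move=> j; apply: nlsc_measurable; exact: nlscZ.
  - by move=> j t _; rewrite mule_ge0// lee_fin.
  rewrite big_filter; apply: eq_bigr => j _; rewrite ge0_integralZl ?lee_fin//.
  exact: nlsc_measurable.
apply: (@le_trans _ _ (\sum_(j | s j ord0) (K * th j)%:E)).
  apply: lee_sum => j sj.
  have [tj|tj] := eqVneq (th j) 0%R; first by rewrite /w tj mulr0 mul0r !mul0e.
  have tj0 : (0 < th j)%R by rewrite lt_neqAle eq_sym tj th0.
  apply: (@le_trans _ _ ((w j)%:E * (c j)%:E)).
    by rewrite lee_wpmul2l ?lee_fin// Cint.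
  by rewrite -EFinM lee_fin /w divfK// gt_eqF.
by rewrite sumEFin -mulr_sumr th1 mulr1.
Qed.

End Finner.

(** * Affine changes of variables *)

Section ChangeOfVariables.
Variable R : realType.
Local Open Scope ereal_scope.
Local Notation mu := (@lebesgue_measure R).

(** By uniqueness of Lebesgue measure: [|a|] times the image measure under [phi] gives each interval
    []c, d]] its length. *)
Lemma integral_affine (a b : R) (f : R -> \bar R) : a != 0%R -> nlsc f ->
  \int[mu]_t f (a * t + b)%R = (`|a|^-1)%:E * \int[mu]_t f t.
Proof.
move=> a0 fl; pose phi (t : measurableTypeR R) : measurableTypeR R := (a * t + b)%R.
have mphi : measurable_fun setT phi.
  by apply: measurable_funD => //; apply: measurable_funM.
have na0 : (0 < `|a|)%R by rewrite normr_gt0.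
pose nu0 := mscale (NngNum (ltW na0)) (pushforward mu phi).
pose nu := nu0 mphi.
have E A : measurable A -> mu A = nu A.
  apply: lebesgue_measure_unique => _ [[c d]] _ <-.
  transitivity (`|a|%:E * mu (phi @^-1` `]c, d]%classic)); last by [].
  have [cd|dc] := ltP c d; last first.
    have -> : `]c, d]%classic = set0 :> set R.
      by rewrite set_itv_ge// bnd_simp -leNgt.
    by rewrite preimage_set0 !measure0 mule0.
  have -> : mu `]c, d]%classic = (d - c)%:E.
    by rewrite lebesgue_measure_itv/= lte_fin cd EFinB.
  have [an|ap] := ltP a 0%R.
    have -> : phi @^-1` `]c, d]%classic = `[((d - b) / a)%R, ((c - b) / a)%R[%classic.
      apply/seteqP; split => t /=; rewrite !in_itv/= /phi.
        by rewrite ler_ndivrMr// ltr_ndivlMr// => /andP[h1 h2]; apply/andP; split; lra.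
      by rewrite ler_ndivrMr// ltr_ndivlMr// => /andP[h1 h2]; apply/andP; split; lra.
    rewrite lebesgue_measure_itv/= lte_fin ltr_nM2r ?invr_lt0// ltrD2r cd.
    by rewrite -EFinB -EFinM ltr0_norm//; congr EFin; field.
  have {}ap : (0 < a)%R by rewrite lt_neqAle eq_sym a0.
  have -> : phi @^-1` `]c, d]%classic = `]((c - b) / a)%R, ((d - b) / a)%R]%classic.
    apply/seteqP; split => t /=; rewrite !in_itv/= /phi.
      by rewrite ler_pdivlMr// ltr_pdivrMr// => /andP[h1 h2]; apply/andP; split; lra.
    by rewrite ler_pdivlMr// ltr_pdivrMr// => /andP[h1 h2]; apply/andP; split; lra.
  rewrite lebesgue_measure_itv/= lte_fin ltr_pM2r ?invr_gt0// ltrD2r cd.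
  by rewrite -EFinB -EFinM gtr0_norm//; congr EFin; field.
have mf := nlsc_measurable fl.
rewrite [X in _ * X](@eq_measure_integral _ _ _ _ nu); last first.
  by move=> A mA _; exact: E.
rewrite ge0_integral_mscale//=; last by move=> x _; case: fl.
rewrite muleA -EFinM mulVf ?gt_eqF// mul1e.
rewrite (ge0_integral_pushforward mphi)//; last by move=> x _; case: fl.
Qed.

Lemma tonelli (f : R * R -> \bar R) : nlsc f ->
  \int[mu]_x \int[mu]_y f (x, y) = \int[mu]_y \int[mu]_x f (x, y).
Proof.
move=> fl; apply: fubini_tonelli; first exact: nlsc_measurable2.
by case: fl.
Qed.

Lemma lebint_integral n (f : 'rV[R]_n * R -> \bar R) : nlsc f ->
  lebint (fun y => \int[mu]_t f (y, t)) = \int[mu]_t lebint (fun y => f (y, t)).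
Proof.
elim: n f => [//|n IH] f fl; rewrite lebintS.
pose g (p : (R * R) * 'rV[R]_n) := f (insert ord0 p.1.1 p.2, p.1.2).
have gl : nlsc g.
  change (nlsc (f \o (fun p : (R * R) * 'rV[R]_n =>
    (insert ord0 p.1.1 p.2, p.1.2)))).
  apply: nlsc_comp fl.
  apply: pairf_continuous; last first.
    by apply: (@compf_continuous _ _ _ fst snd);
      [exact: fst_continuous|exact: snd_continuous].
  apply: (@compf_continuous _ _ _ (fun p : (R * R) * 'rV[R]_n => (p.1.1, p.2))
    (fun p => insert ord0 p.1 p.2)); last exact: insert_continuous.
  apply: pairf_continuous; last exact: snd_continuous.
  by apply: (@compf_continuous _ _ _ fst fst); exact: fst_continuous.
transitivity (\int[mu]_s \int[mu]_t lebint (fun y => g ((s, t), y))).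
  apply: eq_integral => s _.
  apply: (IH (fun p => g ((s, p.2), p.1))).
  change (nlsc (g \o (fun p : 'rV[R]_n * R => ((s, p.2), p.1)))).
  apply: nlsc_comp gl; apply: pairf_continuous; last exact: fst_continuous.
  by apply: pairf_continuous; [exact: cstf_continuous|exact: snd_continuous].
by rewrite (tonelli (nlsc_lebint gl)).
Qed.

(** The induction hypothesis brings the chosen coordinate just below the outermost one, and
    Tonelli's theorem exchanges the two. *)
Lemma lebint_insert n (k : 'I_n.+1) (f : 'rV[R]_n.+1 -> \bar R) : nlsc f ->
  lebint f = \int[mu]_t lebint (fun y => f (insert k t y)).
Proof.
elim: n k f => [|n IH] k f fl; first by rewrite (ord1 k).
case: (unliftP ord0 k) => [k'|] ->; last by [].
pose g (p : (R * R) * 'rV[R]_n) := f (insert ord0 p.1.1 (insert k' p.1.2 p.2)).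
have gl : nlsc g.
  change (nlsc (f \o (fun p : (R * R) * 'rV[R]_n =>
    insert ord0 p.1.1 (insert k' p.1.2 p.2)))).
  apply: nlsc_comp fl.
  apply: (@compf_continuous _ _ _ (fun p : (R * R) * 'rV[R]_n =>
      (p.1.1, insert k' p.1.2 p.2)) (fun p => insert ord0 p.1 p.2));
    last exact: insert_continuous.
  apply: pairf_continuous.
    by apply: (@compf_continuous _ _ _ fst fst); exact: fst_continuous.
  apply: (@compf_continuous _ _ _ (fun p : (R * R) * 'rV[R]_n => (p.1.2, p.2))
    (fun p => insert k' p.1 p.2)); last exact: insert_continuous.
  apply: pairf_continuous; last exact: snd_continuous.
  by apply: (@compf_continuous _ _ _ fst snd);
    [exact: fst_continuous|exact: snd_continuous].
transitivity (\int[mu]_s \int[mu]_t lebint (fun y => g ((s, t), y))).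
  rewrite lebintS; apply: eq_integral => s _.
  by apply: IH; exact: nlsc_insert.
rewrite (tonelli (nlsc_lebint gl)); apply: eq_integral => t _.
rewrite lebintS; apply: eq_integral => s _; apply: eq_lebint => y.
by rewrite insert_lift_cons.
Qed.

Lemma row_inj_unitmx n (K : 'M[R]_n) :
  (forall y : 'rV[R]_n, y *m K = 0%R -> y = 0%R) -> K \in unitmx.
Proof.
move=> Kinj; rewrite -row_free_unit -kermx_eq0; apply/rowV0P => v.
by move=> /sub_kermxP /Kinj.
Qed.

(* Pivoting on a nonzero entry of the first row: integrating first over the
   corresponding coordinate reduces the statement to dimension [n]. *)
Lemma lebint_affine n (N : 'M[R]_n) : N \in unitmx ->
  exists C : R, (0 < C)%R /\ forall (v : 'rV[R]_n) (f : 'rV[R]_n -> \bar R), nlsc f ->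
    lebint (fun y => f (y *m N + v)%R) <= C%:E * lebint f.
Proof.
elim: n N => [|n IH] N Nu.
  exists 1%R; split=> // v f fl; rewrite mul1e /=.
  by rewrite (_ : _ + v = 0)%R//; apply/rowP; case.
have [l c0] : exists l, N ord0 l != 0%R.
  apply: contrapT => N0.
  have : (delta_mx 0%R ord0 : 'rV[R]_n.+1) *m N = 0%R.
    apply/rowP => j; rewrite -rowE !mxE; apply/eqP; apply: contrapT => Nj.
    by apply: N0; exists j; apply/negP.
  move=> /(congr1 (fun x => x *m invmx N)); rewrite mulmxK// mul0mx.
  by move=> /rowP/(_ ord0)/eqP; rewrite !mxE !eqxx oner_eq0.
set c := N ord0 l in c0.
pose p := (\row_j N ord0 (lift l j))%R : 'rV[R]_n.
pose Nl := (\col_i N (lift ord0 i) l)%R : 'cV[R]_n.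
(* [K] is the Schur complement of the pivot [c]. With [c * t + be y] as the variable at position
   [l], the other coordinates are [y *m K] plus a shift depending on that variable alone. *)
pose K := (\matrix_(i, j) (N (lift ord0 i) (lift l j) -
   N (lift ord0 i) l * N ord0 (lift l j) / c))%R : 'M[R]_n.
pose be (y : 'rV[R]_n) := (y *m Nl) 0%R 0%R.
have NE t (y : 'rV[R]_n) : (insert ord0 t y *m N =
    insert l (c * t + be y) ((c * t + be y) *: (c^-1 *: p) + y *m K))%R.
  apply: (rowP_lift (k := l)) => [|j].
    rewrite insert_at mxE big_ord_recl insert_at mulrC; congr (_ + _)%R.
    by rewrite /be mxE; apply: eq_bigr => i _; rewrite insert_lift mxE.
  rewrite insert_lift !mxE big_ord_recl insert_at.
  under eq_bigr do rewrite insert_lift.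
  under [X in _ = (_ + X)%R]eq_bigr do rewrite mxE mulrBr.
  rewrite sumrB.
  have -> : (\sum_i y 0 i * (N (lift ord0 i) l * N ord0 (lift l j) / c) =
     be y * (N ord0 (lift l j) / c))%R.
    rewrite /be mxE mulr_suml; apply: eq_bigr => i _; rewrite mxE; ring.
  by field.
(* A kernel vector of [K] extends to one of [N], the added entry being chosen to cancel the pivot
   variable. *)
have Ku : K \in unitmx.
  apply: row_inj_unitmx => y yK.
  have : insert ord0 (- be y / c)%R y *m N = 0%R.
    rewrite NE yK mulrC divfK// addNr scale0r addr0.
    by apply: (rowP_lift (k := l)) => [|j]; rewrite ?insert_at ?insert_lift !mxE.
  move=> /(congr1 (fun x => x *m invmx N)); rewrite mulmxK// mul0mx => y0.
  apply/rowP => j; rewrite -(insert_lift ord0 (- be y / c)%R y j) y0 !mxE//.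
have [C [C0 HC]] := IH K Ku.
exists (`|c|^-1 * C)%R; split; first by rewrite mulr_gt0// invr_gt0 normr_gt0.
move=> v f fl.
pose v' := (\row_j v 0 (lift l j) - (v 0 l / c) *: p)%R : 'rV[R]_n.
pose g (q : 'rV[R]_n * R) :=
  f (insert l q.2 (q.2 *: (c^-1 *: p) + q.1 *m K + v'))%R.
have gE t y : f (insert ord0 t y *m N + v)%R = g (y, c * t + (be y + v 0 l))%R.
  rewrite /g /=; congr f; rewrite NE; apply: (rowP_lift (k := l)) => [|j].
    by rewrite mxE !insert_at addrA.
  by rewrite mxE !insert_lift !mxE; field.
have gl : nlsc g.
  change (nlsc (f \o (fun q : 'rV[R]_n * R => 
    insert l q.2 (q.2 *: (c^-1 *: p) + q.1 *m K + v')%R))).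
  apply: nlsc_comp fl.
  apply: (@compf_continuous _ _ _ (fun q : 'rV[R]_n * R =>
     (q.2, q.2 *: (c^-1 *: p) + q.1 *m K + v')%R) (fun q => insert l q.1 q.2));
    last exact: insert_continuous.
  apply: pairf_continuous; first exact: snd_continuous.
  apply: rV_continuous => j.
  have -> : (fun q : 'rV[R]_n * R =>
       (q.2 *: (c^-1 *: p) + q.1 *m K + v') 0 j)%R =
     (fun q => q.2 * (c^-1 * p 0 j) + (q.1 *m K + v') 0 j)%R.
    by apply/funext => q; rewrite -addrA mxE; congr (_ + _)%R; rewrite !mxE.
  apply: addf_continuous.
    by apply: mulrc_continuous; exact: snd_continuous.
  apply: (@compf_continuous _ _ _ fst (fun y : 'rV[R]_n => (y *m K + v')%R 0%R j)).
    exact: fst_continuous.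
  apply: (@compf_continuous _ _ _ (fun y : 'rV[R]_n => y *m K + v')%R
    (fun x : 'rV[R]_n => x 0%R j)); last exact: coord_continuous.
  exact: affine_continuous.
pose h (q : 'rV[R]_n * R) := f (insert ord0 q.2 q.1 *m N + v)%R.
have hl : nlsc h.
  apply: (@nlsc_comp _ _ _ (fun q : 'rV[R]_n * R => insert ord0 q.2 q.1)
    (f \o (fun x => (x *m N + v)%R))); last first.
    by apply: nlsc_comp fl; exact: affine_continuous.
  apply: (@compf_continuous _ _ _ (fun q : 'rV[R]_n * R => (q.2, q.1))
    (fun q => insert ord0 q.1 q.2)); last exact: insert_continuous.
  by apply: pairf_continuous; [exact: snd_continuous|exact: fst_continuous].
have ic0 : (0 <= `|c|^-1)%R by rewrite invr_ge0.
have -> : lebint (fun y => f (y *m N + v)%R) =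
    (`|c|^-1)%:E * \int[mu]_t lebint (fun y => g (y, t)).
  rewrite -(lebint_integral gl) -lebintZ//; last exact: nlsc_integral.
  rewrite lebintS -[LHS](lebint_integral hl); apply: eq_lebint => y.
  rewrite -(integral_affine (be y + v 0 l)%R c0 (nlsc_section y gl)).
  by apply: eq_integral => t _; rewrite /h /= gE.
rewrite EFinM -muleA; apply: lee_wpmul2l; first by rewrite lee_fin.
rewrite (lebint_insert l fl) -ge0_integralZl//; last 3 first.
- by apply: nlsc_measurable; exact: nlsc_lebint_insert.
- by move=> t _; apply: lebint_ge0 => y; case: fl.
- by rewrite lee_fin ltW.
apply: ge0_le_integral_nonmeas => t.
  by apply: lebint_ge0 => y; case: gl.
have -> : (fun y => g (y, t)) = (fun y => (fun x => f (insert l t x))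
    (y *m K + (t *: (c^-1 *: p) + v'))%R).
  apply/funext => y; rewrite /g /=; congr (f (insert l t _)).
  by rewrite [RHS]addrA [(y *m K + _)%R]addrC.
exact: HC (nlsc_insert l t fl).
Qed.

End ChangeOfVariables.

(** * Convex functions *)

Section Boxes.
Variable R : realType.
Local Open Scope ereal_scope.

Lemma plebint_predC1 n (k : 'I_n.+1) (f : 'rV[R]_n.+1 -> \bar R) :
  plebint (fun i => i != k) f = lebint (fun y => f (insert k 0%R y)).
Proof.
elim: n k f => [|n IH] k f; first by rewrite (ord1 k).
rewrite plebintS; case: (unliftP ord0 k) => [k'|] ->; last first.
  by rewrite eqxx -plebintT.
rewrite neq_lift lebintS; apply: eq_integral => t _.
have -> : (fun j => lift ord0 j != lift ord0 k') = (fun j => j != k').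
  by apply/funext => j; rewrite (inj_eq lift_inj).
by rewrite IH; apply: eq_lebint => y; rewrite insert_lift_cons.
Qed.

Lemma integral_cst_itv (c : \bar R) (l r : R) : (l < r)%R ->
  \int[@lebesgue_measure R]_t (cst c \_ `]l, r[) t = c * (r - l)%:E.
Proof.
move=> lr; rewrite -integral_mkcond integral_cst; last exact: measurable_itv.
congr (_ * _); rewrite -[LHS]/(lebesgue_measure _) lebesgue_measure_itv/= lte_fin.
by rewrite lr EFinB.
Qed.

Lemma lebint_pinfty n (l r : 'I_n -> R) (f : 'rV[R]_n -> \bar R) :
  (forall j, l j < r j)%R -> (forall x, 0 <= f x) ->
  (forall x : 'rV[R]_n, (forall j, l j < x 0%R j < r j)%R -> f x = +oo) ->
  lebint f = +oo.
Proof.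
elim: n l r f => [|n IH] l r f lr f0 foo; first by apply: foo; case.
rewrite lebintS.
pose g (t : R) : \bar R := (cst +oo \_ `]l ord0, r ord0[) t.
have gf t : g t <= lebint (fun y => f (insert ord0 t y)).
  rewrite /g /patch; case: ifPn => [|_]; last exact: lebint_ge0.
  rewrite inE /= in_itv/= => tlr.
  rewrite (IH (fun j => l (lift ord0 j)) (fun j => r (lift ord0 j)))// => y ylr.
  apply: foo => j; case: (unliftP ord0 j) => [j'|] ->.
    by rewrite insert_lift.
  by rewrite insert_at.
apply/eqP; rewrite eq_le leey/=.
apply: (@le_trans _ _ (\int[@lebesgue_measure R]_t g t)).
  by rewrite integral_cst_itv// gt0_mulye// lte_fin subr_gt0.
apply: ge0_le_integral_nonmeas => // t.
by rewrite /g /patch; case: ifP => _; rewrite ?leey ?lexx.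
Qed.

(** The box is open so that its indicator is lower semicontinuous, hence admissible as a factor in
    Finner's inequality. *)
Definition obox (n : nat) (B : R) : set 'rV[R]_n :=
  [set x | forall j, `|x 0%R j| < B]%R.

Lemma open_obox n (B : R) : open (@obox n B).
Proof.
rewrite openE => x xB; apply: (filter_forall (F := nbhs x)) => j.
have := xB j; rewrite ltr_norml => /andP[h1 h2].
apply/nbhs_ballP; exists (B - `|x 0 j|)%R => /=; first by rewrite subr_gt0 xB.
move=> y [_ /(_ 0%R j)]; rewrite /ball/= !ltr_norml => /andP[h3 h4].
have := ler_norm (x 0%R j); have := ler_norm (- x 0%R j)%R.
by rewrite normrN => h5 h6; apply/andP; split; lra.
Qed.

Lemma lebint_obox n (B : R) : (0 < B)%R ->
  exists V : R, (0 <= V)%R /\ lebint (fun x => (\1_(@obox n B) x)%:E) <= V%:E.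
Proof.
move=> B0; elim: n => [|n [V [V0 HV]]].
  by exists 1%R; split => //=; rewrite lee_fin indicE; case: (_ \in _).
exists (V * (B + B))%R; split; first by rewrite mulr_ge0// addr_ge0// ltW.
rewrite lebintS.
pose g (t : R) : \bar R := (cst V%:E \_ `](- B)%R, B[) t.
apply: (@le_trans _ _ (\int[@lebesgue_measure R]_t g t)); last first.
  by rewrite integral_cst_itv ?opprK//; lra.
apply: ge0_le_integral_nonmeas => t.
  by apply: lebint_ge0 => y; rewrite lee_fin.
rewrite /g /patch; case: ifPn => [_|tB].
  apply: le_trans HV; apply: le_lebint => y; first by rewrite lee_fin.
  rewrite lee_fin !indicE; case: (boolP (_ \in obox _)) => //.
  rewrite !inE /= => yB; rewrite mem_set// => j.
  by have := yB (lift ord0 j); rewrite insert_lift.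
rewrite -[leRHS](lebint0 R n) le_eqVlt; apply/orP; left; apply/eqP.
apply: eq_lebint => y; rewrite indicE memNset//= => /(_ ord0).
rewrite insert_at => tB'; move: tB; rewrite notin_setE /=; apply.
by rewrite in_itv/= -ltr_norml.
Qed.

End Boxes.

Section Orthant.
Variable R : realType.

(* Given a point of [D] in every open orthant at [w], convex combinations make
   the coordinates agree with those of [w] one after the other. *)
Lemma orthant_convex d (D : set 'rV[R]_d) (w : 'rV[R]_d) :
  (forall x y (t : R), D x -> D y -> 0 <= t <= 1 -> D ((1 - t) *: x + t *: y)) ->
  (forall eps : 'I_d -> bool, exists p, D p /\
     forall j, 0 < (if eps j then p 0 j - w 0 j else w 0 j - p 0 j)) ->
  D w.
Proof.
move=> Dc Dw.
have H k : (k <= d)%N -> forall eps : 'I_d -> bool, exists p, D p /\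
    forall j : 'I_d, if (j < k)%N then p 0 j = w 0 j
      else 0 < (if eps j then p 0 j - w 0 j else w 0 j - p 0 j).
  elim: k => [_ eps|k IH kd eps].
    by have [p [Dp hp]] := Dw eps; exists p.
  have kd' : (k <= d)%N by exact: ltnW.
  pose k0 := Ordinal kd.
  pose e b j := if j == k0 then b else eps j.
  have [p [Dp hp]] := IH kd' (e true).
  have [q [Dq hq]] := IH kd' (e false).
  have := hp k0; have := hq k0; rewrite ltnn /e eqxx => b0 a0.
  set al := p 0 k0 - w 0 k0 in a0; set be := w 0 k0 - q 0 k0 in b0.
  have ab0 : 0 < al + be by exact: addr_gt0.
  (* [t] balances the excess [al] of [p] against the deficit [be] of [q]: [(1 - t) * al = t * be].
     The later coordinates keep their signs, common to [p] and [q]. *)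
  pose t := al / (al + be).
  have t0 : 0 < t by exact: divr_gt0.
  have t1 : 0 < 1 - t.
    have -> : 1 - t = be / (al + be) by rewrite /t; field; rewrite gt_eqF.
    exact: divr_gt0.
  exists ((1 - t) *: p + t *: q); split.
    by apply: Dc => //; apply/andP; split; lra.
  move=> j; rewrite ltnS leq_eqVlt !mxE.
  have [jk|jk] /= := eqVneq (val j) k.
    have -> : j = k0 by exact: val_inj.
    have -> : p 0 k0 = w 0 k0 + al by rewrite /al; lra.
    have -> : q 0 k0 = w 0 k0 - be by rewrite /be; lra.
    by rewrite /t; field; rewrite gt_eqF.
  have jk0 : j == k0 = false.
    by apply/negP => /eqP jE; move: jk; rewrite jE eqxx.
  have := hp j; have := hq j; rewrite /e jk0.
  case: ifP => _; first by move=> -> ->; ring.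
  by case: ifP => _ h1 h2; nra.
have [p [Dp hp]] := H d (leqnn d) (fun=> true).
suff -> : w = p by [].
by apply/rowP => j; have := hp j; rewrite ltn_ord.
Qed.

Local Open Scope ereal_scope.

(* [phi] is bounded near [y] by its values at the vertices of a cube, and [y] is
   a convex combination of a nearby [x] and of a point [z] of that cube. *)
Lemma nlsc_convex d (O : set 'rV[R]_d) (phi : 'rV[R]_d -> \bar R) :
  open O ->
  (forall x y (t : R), O x -> O y -> (0 <= t <= 1)%R ->
     O ((1 - t) *: x + t *: y)%R) ->
  (forall x, O x -> 0 <= phi x < +oo) ->
  convex_on O phi ->
  nlsc (phi \_ O).
Proof.
move=> oO Oc phi0 phic.
have w0 x : 0 <= (phi \_ O) x.
  by rewrite /patch; case: ifPn => //; rewrite inE => /phi0 /andP[].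
split => //.
change (forall (y : 'rV[R]_d) (a : R), a%:E < (phi \_ O) y ->
  \forall x \near y, a%:E < (phi \_ O) x) => y a.
have [a0|a0] := ltP a 0%R.
  move=> _; near=> x; apply: lt_le_trans (w0 x); rewrite lte_fin//.
rewrite {1}/patch; case: ifPn => [|_]; last by rewrite lte_fin ltNge a0.
rewrite inE => Oy ay.
have phifin x : O x -> phi x \is a fin_num.
  by move=> /phi0 /andP[h0 hoo]; rewrite ge0_fin_numE.
have /nbhs_ballP[dl /= dl0 dlO] : nbhs y O by exact: open_nbhs_nbhs.
pose vtx (e : {ffun 'I_d -> bool}) : 'rV[R]_d :=
  (\row_j (if e j then y 0 j + dl / 2 else y 0 j - dl / 2))%R.
have Ovtx e : O (vtx e).
  apply: dlO; split => // i j; rewrite (ord1 i) mxE /ball/=.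
  by case: ifP => _; rewrite ltr_norml; apply/andP; split; lra.
pose B := (\sum_e fine (phi (vtx e)))%R.
have B0 : (0 <= B)%R.
  by apply: sumr_ge0 => e _; apply: fine_ge0; have /andP[] := phi0 _ (Ovtx e).
have phiB (z : 'rV[R]_d) : (forall j, `|z 0%R j - y 0%R j| < dl / 2)%R ->
    O z /\ phi z <= B%:E.
  move=> zy; apply: (@orthant_convex _ [set z | O z /\ phi z <= B%:E]) => /=.
    move=> u v t [Ou uB] [Ov vB] /andP[t0 t1]; split.
      by apply: Oc => //; rewrite t0.
    apply: le_trans (phic _ _ _ Ou Ov _) _; first by rewrite t0.
    have -> : B%:E = (1 - t)%:E * B%:E + t%:E * B%:E.
      by rewrite -!EFinM -EFinD; congr EFin; ring.
    by apply: leeD; apply: lee_wpmul2l => //; rewrite lee_fin; lra.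
  move=> eps; exists (vtx [ffun j => eps j]); split; last first.
    move=> j; rewrite mxE ffunE; have := zy j; rewrite ltr_norml => /andP[h1 h2].
    by case: (eps j); lra.
  split; first exact: Ovtx.
  rewrite -(fineK (phifin _ (Ovtx _))) lee_fin /B (bigD1 [ffun j => eps j])//= lerDl.
  by apply: sumr_ge0 => e _; apply: fine_ge0; have /andP[] := phi0 _ (Ovtx e).
pose r := fine (phi y).
have ar : (a < r)%R by rewrite -lte_fin /r fineK// phifin.
(* Small enough that [t * B < r - a]: then [r <= (1 - t) * phi x + t * B] forces [a < phi x], as [a]
   is non-negative. The term [r] in the denominator keeps [t] below 1. *)
pose t := ((r - a) / (2 * (B + r + 1)))%R.
have r0 : (0 <= r)%R by lra.
have t0 : (0 < t)%R by rewrite /t divr_gt0//; lra.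
have tE : (t * (2 * (B + r + 1)) = r - a)%R by rewrite /t divfK// gt_eqF//; lra.
have t1 : (t < 1)%R by rewrite /t ltr_pdivrMr; lra.
clearbody t.
apply/nbhs_ballP; exists (t * (dl / 2))%R => /=; first by rewrite mulr_gt0; lra.
move=> x [_ /(_ 0%R)]; rewrite /ball/= => xy.
(* The point beyond [y] on the line from [x] with [y = (1 - t) *: x + t *: z]. The radius
   [t * (dl / 2)] keeps it inside the cube. *)
pose z := (y + ((1 - t) / t) *: (y - x))%R.
have [Oz zB] : O z /\ phi z <= B%:E.
  apply: phiB => j.
  have -> : (z 0 j - y 0 j = (1 - t) / t * (y 0 j - x 0 j))%R.
    by rewrite /z !mxE; ring.
  rewrite normrM.
  rewrite [X in (X * _)%R]gtr0_norm ?divr_gt0 ?subr_gt0//.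
  rewrite mulrAC ltr_pdivrMr//.
  apply: le_lt_trans (_ : `|y 0 j - x 0 j| < _)%R; last first.
    by have := xy j; lra.
  have := normr_ge0 (y 0%R j - x 0%R j)%R; nra.
have Ox : O x.
  have tx (j : 'I_d) : (`|x 0 j - y 0 j| < dl / 2)%R.
    by rewrite distrC; have := xy j; nra.
  by have [] := phiB x tx.
have yE : y = ((1 - t) *: x + t *: z)%R.
  by apply/rowP => j; rewrite /z !mxE; field; rewrite gt_eqF.
have t01 : (0 <= t <= 1)%R by apply/andP; split; lra.
have := phic x z t Ox Oz t01; rewrite -yE.
rewrite /patch mem_set// -(fineK (phifin _ Oy)) -/r.
have zf := phifin _ Oz; have xf := phifin _ Ox.
rewrite -(fineK zf) -(fineK xf) -!EFinM -EFinD lee_fin lte_fin => h.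
move: zB; rewrite -(fineK zf) lee_fin => zB.
nra.
Unshelve. all: by end_near. Qed.

(* The convex set where [phi] is finite misses [y], hence an open orthant at
   [y]. *)
Lemma lebint_convex_pinfty d (O : set 'rV[R]_d) (phi : 'rV[R]_d -> \bar R) y :
  open O ->
  (forall x, O x -> 0 <= phi x) ->
  (forall x y (t : R), O x -> O y -> (0 <= t <= 1)%R ->
     O ((1 - t) *: x + t *: y)%R) ->
  convex_on O phi -> O y -> phi y = +oo ->
  lebint (phi \_ O) = +oo.
Proof.
move=> oO phi0 Oc phic Oy phiy.
have /nbhs_ballP[dl /= dl0 dlO] : nbhs y O by exact: open_nbhs_nbhs.
pose D := [set x | O x /\ phi x < +oo].
have [eps He] : exists eps : 'I_d -> bool, forall p : 'rV[R]_d,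
    (forall j, 0 < (if eps j then p 0 j - y 0 j else y 0 j - p 0 j))%R -> ~ D p.
  apply: contrapT => nE.
  have : D y; last by case=> _; rewrite phiy.
  apply: orthant_convex.
    move=> u v t [Ou uoo] [Ov voo] t01; split; first exact: Oc.
    apply: le_lt_trans (phic _ _ _ Ou Ov t01) _.
    have uf : phi u \is a fin_num by rewrite ge0_fin_numE ?phi0.
    have vf : phi v \is a fin_num by rewrite ge0_fin_numE ?phi0.
    by rewrite -(fineK uf) -(fineK vf) -!EFinM -EFinD ltry.
  move=> eps; apply: contrapT => nP; apply: nE; exists eps => p hp Dp.
  by apply: nP; exists p.
apply: (@lebint_pinfty _ _ (fun j => if eps j then y 0 j else y 0 j - dl)%R
   (fun j => if eps j then y 0 j + dl else y 0 j)%R).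
- by move=> j; case: ifP => _; lra.
- by move=> x; rewrite /patch; case: ifPn => //; rewrite inE => /phi0.
- move=> x hx.
  have Ox : O x.
    apply: dlO; split => // i j; rewrite (ord1 i) /ball/= ltr_norml.
    by have := hx j; case: ifP => _ /andP[h1 h2]; apply/andP; split; lra.
  rewrite /patch mem_set//; apply/eqP; rewrite -leye_eq leNgt; apply/negP => xoo.
  apply: (He x) => // j; have := hx j.
  by case: ifP => _ /andP[h1 h2]; lra.
Qed.

End Orthant.

(** * Facets of the polytope *)

Section HyperplaneProjection.
Variable R : realType.

(* The projection along the [k]-th axis onto the hyperplane [dotv x a = b]
   (the identity when [a 0 k = 0], since then the quotient is 0). *)
Definition proj n (a : 'rV[R]_n) (b : R) (k : 'I_n) (x : 'rV[R]_n) : 'rV[R]_n :=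
  x + ((b - dotv x a) / a 0 k) *: delta_mx 0 k.

Lemma dotv_proj n (a c : 'rV[R]_n) b k x :
  dotv (proj a b k x) c = dotv x c + (b - dotv x a) / a 0 k * c 0 k.
Proof. by rewrite /proj dotvDl dotvZl dotv_delta. Qed.

Lemma proj_on n (a : 'rV[R]_n) b k x : a 0 k != 0 -> dotv (proj a b k x) a = b.
Proof. by move=> ak; rewrite dotv_proj divfK// addrC subrK. Qed.

(** In the parameters of the hyperplane the projection is affine. It changes only the [k]-th
    coordinate, so it is injective on the points where that coordinate is 0: [K] is invertible and a
    change of variables applies. *)
Lemma proj_affine d (a : 'rV[R]_d.+1) b (o : 'rV[R]_d.+1)
    (M : 'M[R]_(d, d.+1)) (k : 'I_d.+1) :
  hyperplane_param a b o M -> a 0 k != 0 ->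
  exists (N : 'M[R]_(d.+1, d)) (v : 'rV[R]_d) (K : 'M[R]_d),
    [/\ forall x, proj a b k x = o + (x *m N + v) *m M, K \in unitmx &
        forall y, insert k 0 y *m N + v = y *m K + v].
Proof.
move=> [Mf Mp] ak.
pose dk : 'rV[R]_d.+1 := (a 0 k)^-1 *: delta_mx 0 k.
pose L := 1%:M - a^T *m dk.
pose w := b *: dk - o.
have dotE x : x *m a^T = (dotv x a)%:M.
  apply/matrixP => i j; rewrite !ord1 !mxE eqxx mulr1n.
  by apply: eq_bigr => l _; rewrite mxE.
have projE x : proj a b k x = o + (x *m L + w).
  rewrite /proj /L /w mulmxBr mulmx1 mulmxA dotE mul_scalar_mx /dk.
  by apply/rowP => j; rewrite !mxE; ring.
pose E : 'M[R]_(d, d.+1) := \matrix_(i, j) (lift k i == j)%:R.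
have insE y : insert k 0 y = y *m E.
  apply: (rowP_lift (k := k)) => [|j].
    rewrite insert_at mxE big1// => i _.
    by rewrite mxE eq_sym (negbTE (neq_lift _ _)) mulr0.
  rewrite insert_lift mxE (bigD1 j)//= mxE eqxx mulr1 big1 ?addr0// => i ij.
  by rewrite mxE (inj_eq lift_inj) (negbTE ij) mulr0.
(* As [M] is row free, [pinvmx M] recovers the parameter of a point of the hyperplane. *)
have pE x : proj a b k x = o + (x *m (L *m pinvmx M) + w *m pinvmx M) *m M.
  have [y Hy] := (Mp _).1 (proj_on b x ak).
  have yE : x *m L + w = y *m M.
    by apply: (addrI o); rewrite -projE.
  by rewrite mulmxA -mulmxDl yE -(mulmxA y) (mulmxVp Mf) mulmx1.
exists (L *m pinvmx M), (w *m pinvmx M), (E *m (L *m pinvmx M)); split => //.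
  apply: row_inj_unitmx => y yK.
  have := pE (insert k 0 y); rewrite insE -mulmxA yK.
  have := pE 0; rewrite mul0mx => <- /rowP pj.
  apply/rowP => j; have := pj (lift k j).
  rewrite -insE !mxE; have -> : (lift k j == k) = false.
    by rewrite eq_sym (negbTE (neq_lift _ _)).
  by rewrite liftK andbF !mulr0 !addr0.
by move=> y; rewrite insE !mulmxA.
Qed.

End HyperplaneProjection.

Section Polytope.
Variables (R : realType) (d m : nat).
Variables (a : 'I_m -> 'rV[R]_d.+1) (b : 'I_m -> R).
Hypothesis arep : simple_polytope_rep a b.

Lemma polyh_obox : exists2 B : R, 0 < B & polyh a b `<=` @obox R d.+1 B.
Proof.
case: arep => _ [Pc _ _ _ _].
have Hj (j : 'I_d.+1) : exists B : R, forall x, polyh a b x -> `|x 0 j| <= B.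
  have : compact ((fun x : 'rV[R]_d.+1 => x 0 j) @` polyh a b).
    apply: continuous_compact => //.
    by apply: continuous_subspaceT; exact: coord_continuous.
  move=> /compact_bounded [B [_ HB]]; exists (B + 1) => x Px.
  apply: (HB (B + 1)); first by rewrite ltrDl.
  by exists x.
have /choice[B HB] := Hj.
exists (1 + \sum_j `|B j|); first by rewrite ltr_pwDl// sumr_ge0.
move=> x Px j; apply: le_lt_trans (HB j x Px) _.
apply: (le_lt_trans (ler_norm _)); rewrite (bigD1 j)//= addrCA ltrDl.
by rewrite ltr_pwDl// sumr_ge0.
Qed.

(* The hyperplane of the points whose projection along the [k]-th axis to the
   [i]-th facet hyperplane lies on the [j]-th one is proper (or empty). *)
Lemma facet_pair_nondegenerate (i j : 'I_m) (k : 'I_d.+1) :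
  i != j -> a i 0 k != 0 ->
  a j - (a j 0 k / a i 0 k) *: a i != 0 \/ b j - a j 0 k / a i 0 k * b i != 0.
Proof.
case: arep => a0 [_ [x0 x0i] _ Finj _] ij aik.
set la := a j 0 k / a i 0 k.
have [aE|] := eqVneq (a j - la *: a i) 0; last by left.
right; apply/negP => /eqP bE.
have ajE : a j = la *: a i by apply/eqP; rewrite -subr_eq0 aE.
have bjE : b j = la * b i by apply/eqP; rewrite -subr_eq0 bE.
have la0 : la != 0.
  by apply: contra_neq (a0 j); rewrite ajE => ->; rewrite scale0r.
have dE x : dotv x (a j) = la * dotv x (a i).
  by rewrite dotvC ajE dotvZl dotvC.
(* The [j]-th constraint is now [la] times the [i]-th. If [la > 0] the two faces coincide, against
   irredundancy; if [la < 0] the polytope lies in a hyperplane, against its non-empty interior. *)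
have [lan|lap] := ltP la 0; last first.
  have {}lap : 0 < la by rewrite lt_neqAle eq_sym la0.
  move/eqP: ij; apply; apply: Finj; apply/seteqP.
  have H x : dotv x (a i) = b i <-> dotv x (a j) = b j.
    by rewrite dE bjE; split => [->//|/(mulfI la0)].
  by split => x [Px /H xE].
have tight x : polyh a b x -> dotv x (a i) = b i.
  move=> Px; apply/eqP; rewrite eq_le Px /=.
  by have := Px j; rewrite dE bjE ler_nM2l.
have Px0 : polyh a b x0 by exact: interior_subset.
have /nbhs_ballP[e /= e0 eP] : nbhs x0 (polyh a b) by exact: x0i.
have Px1 : polyh a b (x0 + (e / 2) *: delta_mx 0 k).
  apply: eP; split => // i' j'; rewrite !mxE /ball/= opprD addNKr normrN.
  case: (_ && _); rewrite ?mulr1 ?mulr0 ?normr0// ger0_norm; lra.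
have := tight _ Px1; rewrite dotvDl dotvZl dotv_delta (tight _ Px0).
move=> /eqP; rewrite -subr_eq0 addrAC subrr add0r mulf_eq0 (negbTE aik) orbF.
by rewrite gt_eqF//; lra.
Qed.

(** Among the constraints that tighten along the ray of direction [s] on the [k]-th axis, the exit
    facet minimizes the time [tau] at which equality is reached. The other constraints stay
    satisfied. *)
Lemma polyh_exit (k : 'I_d.+1) (s : R) x :
  s = 1 \/ s = -1 -> polyh a b x ->
  exists i, [/\ 0 < s * a i 0 k, 0 <= s * ((b i - dotv x (a i)) / a i 0 k) &
     polyh a b (proj (a i) (b i) k x)].
Proof.
move=> s1 Px; have ss : s * s = 1 by case: s1 => ->; ring.
have [B B0 PB] := polyh_obox.
(* If no constraint tightened, a step of length [2 * B] would stay in the polytope but leave the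
   bounding box. *)
have [i0 Hi0] : exists i, 0 < s * a i 0 k.
  apply: contrapT => nE.
  have ns i : s * a i 0 k <= 0.
    by rewrite leNgt; apply/negP => h; apply: nE; exists i.
  pose T := 2 * B.
  have PT : polyh a b (x + (s * T) *: delta_mx 0 k).
    move=> i; rewrite dotvDl dotvZl dotv_delta.
    by have := Px i; have := ns i; rewrite /T; nra.
  have := PB _ PT k; have := PB _ Px k; rewrite !mxE !eqxx mulr1 !ltr_norml.
  by move=> /andP[h1 h2] /andP[]; case: s1 => ->; rewrite /T; lra.
pose tau i := (b i - dotv x (a i)) / (s * a i 0 k).
case: (@arg_minP _ _ _ i0 (fun i => 0 < s * a i 0 k) tau Hi0) => i Hi imin.
have tauE j : 0 < s * a j 0 k -> s * ((b j - dotv x (a j)) / a j 0 k) = tau j.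
  move=> h; have sj : s != 0 by apply: contraTneq h => ->; rewrite mul0r ltxx.
  have aj : a j 0 k != 0 by apply: contraTneq h => ->; rewrite mulr0 ltxx.
  by rewrite /tau -[LHS]mul1r -{1}ss; field: ss; rewrite sj aj.
have tau0 : 0 <= tau i.
  by apply: divr_ge0; [rewrite subr_ge0; exact: Px|exact: ltW].
exists i; split; [by []|by rewrite tauE|move=> j].
rewrite dotv_proj.
have -> : (b i - dotv x (a i)) / a i 0 k = s * tau i.
  by rewrite -(tauE i Hi) mulrA ss mul1r.
have [Hj|Hj] := ltP 0 (s * a j 0 k).
  have := imin j Hj; rewrite {2}/tau ler_pdivlMr// => h; nra.
by have := Px j; nra.
Qed.

(** The point lies between its exits in the two directions of the axis. Their facets differ because
    the normals have [k]-th entries of opposite signs. Convexity, with coefficients at most 1, gives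
    the bound. *)
Lemma convex_le_proj (u : 'rV[R]_d.+1 -> \bar R) (k : 'I_d.+1) x :
  (forall x, polyh a b x -> (0 <= u x)%E) -> convex_on (polyh a b) u ->
  polyh a b x ->
  exists i j, [/\ i != j, a i 0 k != 0 & a j 0 k != 0] /\
    [/\ polyh a b (proj (a i) (b i) k x), polyh a b (proj (a j) (b j) k x) &
    (u x <= u (proj (a i) (b i) k x) + u (proj (a j) (b j) k x))%E].
Proof.
move=> u0 uc Px.
have [i [si ti Pi]] := polyh_exit k (or_introl erefl) Px.
have [j [sj tj Pj]] := polyh_exit k (or_intror erefl) Px.
rewrite !mul1r in si ti; rewrite !mulN1r in sj tj.
exists i, j; split; split => //.
- by apply/eqP => ij; move: sj; rewrite -ij; lra.
- by rewrite gt_eqF.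
- by rewrite lt_eqF//; lra.
move: Pi Pj; rewrite /proj.
move: ti tj; rewrite ?mul1r ?mulN1r; set p := (b i - _) / _.
set q := (b j - _) / _ => p0 q0 Pi Pj.
have [s0|s0] := eqVneq (p - q) 0.
  have -> : p = 0 by lra.
  by rewrite scale0r addr0 leeDl// u0.
clearbody p q.
have s1 : 0 < p - q by rewrite lt_neqAle eq_sym s0; lra.
pose t := p / (p - q).
have t01 : 0 <= t <= 1.
  apply/andP; split; first exact: divr_ge0 p0 (ltW s1).
  by rewrite /t ler_pdivrMr ?mul1r//; lra.
have xE : x = (1 - t) *: (x + p *: delta_mx 0 k) + t *: (x + q *: delta_mx 0 k).
  by apply/rowP => l; rewrite !mxE /t; field.
rewrite {1}xE; apply: le_trans (uc _ _ _ Pi Pj t01) _.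
move/andP: t01 => [h1 h2].
by apply: leeD; rewrite -[leRHS]mul1e lee_wpmul2r ?u0// lee_fin; lra.
Qed.

End Polytope.

Section Facets.
Variables (R : realType) (d m : nat).
Variables (a : 'I_m -> 'rV[R]_d.+1) (b : 'I_m -> R).
Variables (o : 'I_m -> 'rV[R]_d.+1) (M : 'I_m -> 'M[R]_(d, d.+1)).
Hypothesis oMp : forall i, hyperplane_param (a i) (b i) (o i) (M i).
Implicit Types (i j : 'I_m) (u : 'rV[R]_d.+1 -> \bar R).

(** The relatively open facet in the parameters of its hyperplane. Constraint [i] is left out, being
    an equality there; strictness of the others makes the set open, as the results on convex
    functions require. *)
Definition ofacet i : set 'rV[R]_d :=
  [set y | forall j, j != i -> dotv (o i + y *m M i) (a j) < b j].

Definition facet_fun u i : 'rV[R]_d -> \bar R :=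
  (fun y => u (o i + y *m M i)) \_ (ofacet i).

Lemma param_on i y : dotv (o i + y *m M i) (a i) = b i.
Proof. by apply/(oMp i).2; exists y. Qed.

Lemma open_ofacet i : open (ofacet i).
Proof.
rewrite openE => y yO; apply: (filter_forall (F := nbhs y)) => j.
case: (eqVneq j i) => [->|ji].
  by apply: (filterS (P := setT)) => //; exact: filterT.
have c : continuous (fun y : 'rV[R]_d => dotv (y *m M i + o i) (a j)).
  apply: (@compf_continuous _ _ _ (fun y : 'rV[R]_d => y *m M i + o i)
    (fun x => dotv x (a j))); last exact: dotv_continuous.
  exact: affine_continuous.
have yj := yO j ji.
have : \forall z \near y, dotv (z *m M i + o i) (a j) < b j.
  by apply: (cvgr_lt _ (c y)); rewrite addrC.
by apply: filterS => z; rewrite addrC.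
Qed.

Lemma param_convex i (x y : 'rV[R]_d) t :
  o i + ((1 - t) *: x + t *: y) *m M i =
  (1 - t) *: (o i + x *m M i) + t *: (o i + y *m M i).
Proof.
rewrite mulmxDl -!scalemxAl; apply/rowP => j; rewrite !mxE; ring.
Qed.

Lemma ofacet_convex i (x y : 'rV[R]_d) (t : R) :
  ofacet i x -> ofacet i y -> 0 <= t <= 1 -> ofacet i ((1 - t) *: x + t *: y).
Proof.
move=> xO yO /andP[t0 t1] j ji; rewrite param_convex dotvDl !dotvZl.
have := xO j ji; have := yO j ji => yj xj; have [t0'|t0'] := ltP 0 t.
  have h1 : 0 < t * (b j - dotv (o i + y *m M i) (a j)) by rewrite mulr_gt0// subr_gt0.
  have h2 : 0 <= (1 - t) * (b j - dotv (o i + x *m M i) (a j)).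
    by rewrite mulr_ge0// subr_ge0// ltW.
  lra.
have -> : t = 0 by lra.
lra.
Qed.

Lemma ofacet_polyh i y : ofacet i y -> polyh a b (o i + y *m M i).
Proof.
move=> yO j; have [->|ji] := eqVneq j i; first by rewrite param_on.
exact/ltW/yO.
Qed.

Section Convex.
Variable u : 'rV[R]_d.+1 -> \bar R.
Hypothesis u0 : forall x, polyh a b x -> (0 <= u x)%E.
Hypothesis uc : convex_on (polyh a b) u.

Lemma facet_fun_ge0 i y : (0 <= facet_fun u i y)%E.
Proof.
rewrite /facet_fun /patch; case: ifPn => //; rewrite inE => yO.
exact/u0/ofacet_polyh.
Qed.

Lemma facet_fun_le i y :
  (facet_fun u i y <= (u \_ (face_i a b i)) (o i + y *m M i)%R)%E.
Proof.
rewrite /facet_fun /patch; case: ifPn => [|_].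
  rewrite inE => yO; rewrite mem_set//; split; [exact: ofacet_polyh|exact: param_on].
by case: ifPn => //; rewrite inE => -[/u0].
Qed.

(** Convexity survives the affine parametrization, so one of the two results on convex functions on
    open sets applies. A finite boundary integral will exclude the second case. *)
Lemma facet_fun_dichotomy i :
  nlsc (facet_fun u i) \/ lebint (facet_fun u i) = +oo%E.
Proof.
have uO y : ofacet i y -> (0 <= u (o i + y *m M i)%R)%E.
  by move=> /ofacet_polyh; exact: u0.
have ucO : convex_on (ofacet i) (fun y => u (o i + y *m M i)).
  move=> x y t xO yO t01; rewrite param_convex.
  by apply: uc => //; exact: ofacet_polyh.
have [[y [yO uy]]|nE] :=
  pselect (exists y, ofacet i y /\ u (o i + y *m M i) = +oo%E).
  right; apply: (@lebint_convex_pinfty _ _ (ofacet i)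
    (fun y => u (o i + y *m M i)) y) => //; first exact: open_ofacet.
  exact: ofacet_convex.
left; apply: nlsc_convex => //; first exact: open_ofacet.
  exact: ofacet_convex.
move=> x xO; rewrite uO//= ltey; apply/eqP => ux.
by apply: nE; exists x.
Qed.

End Convex.

End Facets.

(** * Projections onto the facets and the volume estimate *)

Section Assembly.
Variables (R : realType) (d m : nat).
Variables (a : 'I_m -> 'rV[R]_d.+1) (b : 'I_m -> R).
Variables (o : 'I_m -> 'rV[R]_d.+1) (M : 'I_m -> 'M[R]_(d, d.+1)).
Hypothesis oMp : forall i, hyperplane_param (a i) (b i) (o i) (M i).

(** Because the projection ignores the [k]-th coordinate, values at projected points can form a
    factor of Finner's inequality masked at [k]. *)
Lemma proj_mask (c : 'rV[R]_d.+1) (be : R) (k : 'I_d.+1) x : c 0 k != 0 ->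
  proj c be k (mask (fun i => i != k) x) = proj c be k x.
Proof.
move=> ck; have -> : mask (fun i => i != k) x = x + (- x 0 k) *: delta_mx 0 k.
  apply/rowP => j; rewrite !mxE; have [->|jk] := eqVneq j k.
    by rewrite eqxx mulr1 subrr.
  by rewrite andbF mulr0 addr0.
rewrite /proj dotvDl dotvZl dotv_delta.
by apply/rowP => j; rewrite !mxE; field.
Qed.

(** Fixes matrices, shifts and constants for all facets and axes before [u] is given, so that the
    final constant is independent of [u]. *)
Lemma facet_proj_comparison : exists (N : 'I_m -> 'I_d.+1 -> 'M[R]_(d.+1, d))
    (v : 'I_m -> 'I_d.+1 -> 'rV[R]_d) (C : 'I_m -> 'I_d.+1 -> R),
  forall i k, 0 < C i k /\ (a i 0 k != 0 ->
    (forall x, proj (a i) (b i) k x = o i + (x *m N i k + v i k) *m M i) /\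
    forall f : 'rV[R]_d -> \bar R, nlsc f ->
      (lebint (fun y => f (insert k 0 y *m N i k + v i k)%R) <=
       (C i k)%:E * lebint f)%E).
Proof.
have H (p : 'I_m * 'I_d.+1) : exists t : ('M[R]_(d.+1, d) * 'rV[R]_d) * R,
    0 < t.2 /\ (a p.1 0 p.2 != 0 ->
    (forall x, proj (a p.1) (b p.1) p.2 x =
       o p.1 + (x *m t.1.1 + t.1.2) *m M p.1) /\
    forall f : 'rV[R]_d -> \bar R, nlsc f ->
      (lebint (fun y => f (insert p.2 0 y *m t.1.1 + t.1.2)%R) <=
       t.2%:E * lebint f)%E).
  case: p => i k /=.
  have [aik0|aik] := eqVneq (a i 0 k) 0; first by exists ((0, 0), 1).
  have [N [v [K [pE Ku KE]]]] := proj_affine (oMp i) aik.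
  have [C [C0 HC]] := lebint_affine Ku.
  exists ((N, v), C); split => //= _; split => // f fl.
  by under eq_lebint => y do rewrite KE; exact: HC.
have /choice[t Ht] := H.
exists (fun i k => (t (i, k)).1.1), (fun i k => (t (i, k)).1.2),
  (fun i k => (t (i, k)).2) => i k.
exact: (Ht (i, k)).
Qed.

End Assembly.

Section Bound.
Variables (R : realType) (d m : nat).
Variables (a : 'I_m -> 'rV[R]_d.+1) (b : 'I_m -> R).
Variables (o : 'I_m -> 'rV[R]_d.+1) (M : 'I_m -> 'M[R]_(d, d.+1)).
Hypothesis oMp : forall i, hyperplane_param (a i) (b i) (o i) (M i).
Hypothesis arep : simple_polytope_rep a b.
Local Open Scope ereal_scope.

Lemma poweR_prod_const n (x : \bar R) (r : R) : (0 < r)%R -> 0 <= x ->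
  \prod_(k < n) x `^ r = x `^ (n%:R * r).
Proof.
move=> r0 x0; elim: n => [|n IH]; first by rewrite big_ord0 mul0r poweRe0.
rewrite big_ord_recl IH -natr1 mulrDl mul1r addrC poweRD//.
by apply: add_neq0_poweRD_def; rewrite gt_eqF// ltr_pwDl// mulr_ge0// ltW.
Qed.

(* Convexity bounds [u x], for every direction [k], by a sum of values of [u]
   on the facets, at points depending only on the coordinates of [x] other
   than the [k]-th: the hypotheses of Finner's inequality. *)
Lemma lebint_pow_le (q : R) (csig : 'I_m -> R) :
  (0 < q)%R -> (d%:R * q <= d.+1%:R)%R -> (forall i, 0 < csig i)%R ->
  exists D : R, (0 < D)%R /\ forall (u : 'rV[R]_d.+1 -> \bar R) (S : R),
    (forall x, polyh a b x -> 0 <= u x) -> convex_on (polyh a b) u ->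
    (forall i, nlsc (facet_fun a b o M u i)) -> (0 < S)%R ->
    (forall i, lebint (facet_fun a b o M u i) <= (S / csig i)%:E) ->
    lebint ((fun x => u x `^ q) \_ (polyh a b)) <= (D * S `^ q)%:E.
Proof.
move=> q0 qd csig0.
have [B B0 PB] := polyh_obox arep.
have [V [V0 HV]] := lebint_obox d.+1 B0.
have [N [v [C HC]]] := facet_proj_comparison oMp.
pose r := (q / d.+1%:R)%R.
have r0 : (0 < r)%R by rewrite divr_gt0.
have rq : (d.+1%:R * r = q)%R by rewrite mulrC divfK// pnatr_eq0.
(* Exponent of the box. Each coordinate occurs in [d] of the factors [f k], of exponent [r], and in
   the box; the exponents must add up to 1. The bound on [q] makes it non-negative. *)
pose th0 := (1 - d%:R * r)%R.
have th00 : (0 <= th0)%R.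
  by rewrite subr_ge0 /r mulrA ler_pdivrMr ?ltr0n// mul1r.
pose ck k := (1 + \sum_(i | a i 0%R k != 0%R) C i k / csig i)%R.
have ck0 k : (0 < ck k)%R.
  rewrite ltr_pwDl// sumr_ge0// => i _.
  by rewrite divr_ge0// ltW//; case: (HC i k).
exists ((V + 1) `^ th0 * \prod_k (ck k `^ r))%R; split.
  apply: mulr_gt0; first by rewrite powR_gt0// ltr_wpDl.
  by apply: prodr_gt0 => k _; exact: powR_gt0.
move=> u S u0 uc fl S0 HS.
pose w := facet_fun a b o M u.
have w0 i y : 0 <= w i y by case: (fl i).
pose f k x := \sum_(i | a i 0%R k != 0%R) w i (x *m N i k + v i k)%R.
have fnl k : nlsc (f k).
  apply: nlsc_sum => i _; apply: (nlsc_comp _ (fl i)).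
  exact: affine_continuous.
(* Index 0 stands for the box and [lift ord0 k] for the axis [k], here and in [s], [th] and [c]. *)
pose F (j : 'I_d.+2) := if unlift ord0 j is Some k then f k
  else fun x => (\1_(@obox R d.+1 B) x)%:E.
pose s (j : 'I_d.+2) (i : 'I_d.+1) :=
  if unlift ord0 j is Some k then i != k else true.
pose th (j : 'I_d.+2) := if unlift ord0 j is Some k then r else th0.
pose c (j : 'I_d.+2) :=
  if unlift ord0 j is Some k then (ck k * S)%R else (V + 1)%R.
have fk k : plebint (fun i => i != k) (f k) <= (ck k * S)%:E.
  rewrite plebint_predC1 /f lebint_sum; last first.
    move=> i _; apply: (@nlsc_insert _ _ _ _ (fun x => w i (x *m N i k + v i k)%R)).
    by apply: (nlsc_comp _ (fl i)); exact: affine_continuous.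
  apply: (@le_trans _ _ (\sum_(i | a i 0%R k != 0%R) (C i k / csig i * S)%:E)).
    apply: lee_sum => i aik; have [C0 /(_ aik)[_ HCf]] := HC i k.
    apply: le_trans (HCf _ (fl i)) _.
    rewrite -mulrA [(_ * S)%R]mulrC EFinM; apply: lee_wpmul2l (HS i).
    by rewrite lee_fin ltW.
  by rewrite sumEFin lee_fin -mulr_suml /ck mulrDl lerDr mul1r ltW.
have key : lebint (fun x => \prod_j (F j (mask (s j) x) `^ th j)) <=
    (\prod_j (c j `^ th j)%R)%:E.
  apply: finner => [j|j|i|j|j _].
  - by rewrite /th; case: unlift => // k; exact: ltW.
  - rewrite /c; case: unlift => [k|]; first exact: mulr_gt0.
    by rewrite ltr_wpDl.
  - rewrite big_mkcond big_ord_recl /s /th unlift_none.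
    under eq_bigr do rewrite liftK.
    rewrite -big_mkcond/=.
    have -> : (\sum_(k < d.+1 | i != k) r = d%:R * r)%R.
      rewrite (eq_bigl (predC1 i)) => [|k]; last by rewrite eq_sym.
      by rewrite sumr_const cardC1 card_ord mulr_natl.
    by rewrite /th0 subrK.
  - rewrite /F; case: unlift => [k|]; first exact: fnl.
    exact/nlsc_indic/open_obox.
  - rewrite /F /s /c; case: unlift => [k|]; first exact: fk.
    by rewrite plebintT (le_trans HV)// lee_fin lerDl.
have prodc : (\prod_j (c j `^ th j) =
    (V + 1) `^ th0 * \prod_k (ck k `^ r) * S `^ q)%R.
  rewrite big_ord_recl /c /th unlift_none -mulrA; congr (_ * _)%R.
  rewrite (eq_bigr (fun k => ck k `^ r * S `^ r)%R) => [|k _]; last first.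
    by rewrite liftK powRM// ltW.
  rewrite big_split/=; congr (_ * _)%R.
  by rewrite prodr_const card_ord -powR_mulrn ?powR_ge0// -powRrM mulrC rq.
rewrite -prodc; apply: le_trans key.
(* Excluded are the points whose projection along [k] to the hyperplane [i] also lies on the
   hyperplane [j]. Triples that are not [bad] get the equation 0 = 1, which holds nowhere. *)
pose bad (p : 'I_d.+1 * ('I_m * 'I_m)) :=
  (p.2.1 != p.2.2) && (a p.2.1 0%R p.1 != 0%R).
pose la (p : 'I_d.+1 * ('I_m * 'I_m)) := (a p.2.2 0 p.1 / a p.2.1 0 p.1)%R.
pose al p := (if bad p then a p.2.2 - la p *: a p.2.1 else 0)%R.
pose be p := (if bad p then b p.2.2 - la p * b p.2.1 else 1)%R.
apply: (@le_lebint_off _ _ _ al be).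
- move=> [k [i j]]; rewrite /al /be; case: ifPn => [/andP[ij aik]|_].
    exact: (facet_pair_nondegenerate arep).
  by right; exact: oner_neq0.
- by move=> x; rewrite /patch; case: ifP => // _; exact: poweR_ge0.
- by move=> x; apply: prode_ge0 => j _; exact: poweR_ge0.
move=> x hx; rewrite /patch; case: ifPn => [|_]; last first.
  by apply: prode_ge0 => j _; exact: poweR_ge0.
rewrite inE => Px.
(* Off these hyperplanes, a projection lying in the polytope satisfies the other constraints
   strictly, so the cut-off function takes the value of [u] there. *)
have opn i k : a i 0%R k != 0%R -> polyh a b (proj (a i) (b i) k x) ->
    w i (mask (fun l => l != k) x *m N i k + v i k)%R = u (proj (a i) (b i) k x).
  move=> aik Pp; have [_ /(_ aik)[pE _]] := HC i k.
  rewrite /w /facet_fun /patch -pE proj_mask// mem_set// => j ji.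
  rewrite -pE proj_mask// lt_neqAle Pp andbT; apply/eqP => E.
  have := hx (k, (i, j)); rewrite /al /be /bad /= eq_sym ji aik /=; apply.
  rewrite /la/= dotvC dotvDl -scaleNr dotvZl ![dotv (a _) _]dotvC -E dotv_proj.
  by field.
have uf k : u x <= f k (mask (fun l => l != k) x).
  have [i [j [[ij aik ajk] [Pi Pj ux]]]] := convex_le_proj arep k u0 uc Px.
  apply: (le_trans ux); rewrite /f (bigD1 i)//= (bigD1 j)/=; last first.
    by rewrite ajk eq_sym.
  by rewrite !opn// leeD2l// leeDl// sume_ge0.
(* The power [q] of [u x] splits into [d.+1] equal factors, one for each axis; the indicator of the
   box is 1 at [x]. *)
rewrite -rq -poweR_prod_const ?u0// [leRHS]big_ord_recl /F /s /th unlift_none.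
under [X in _ <= _ * X]eq_bigr do rewrite liftK.
rewrite indicE mem_set; last first.
  by move=> j; rewrite mxE; exact: PB.
rewrite poweR1r mul1e; apply: lee_prod => k _; rewrite poweR_ge0/=.
apply: gt0_ler_poweR; [exact: ltW|..|exact: uf].
- by rewrite in_itv/= u0// leey.
- by rewrite in_itv/= leey andbT; case: (fnl k).
Qed.

End Bound.

(** * From the facet integrals to the boundary integral *)

Lemma lebint_bound_boundary (R : realType) (d m : nat)
  (a : 'I_m -> 'rV[R]_d.+1) (b : 'I_m -> R)
  (cmu : R) (csig : 'I_m -> R)
  (o : 'I_m -> 'rV[R]_d.+1) (M : 'I_m -> 'M[R]_(d, d.+1)) (q : R) :
  simple_polytope_rep a b -> 0 < cmu -> (forall i, 0 < csig i) ->
  (forall i, hyperplane_param (a i) (b i) (o i) (M i)) ->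
  0 < q -> d%:R * q <= d.+1%:R ->
  exists C : R, 0 < C /\
    forall u : 'rV[R]_d.+1 -> \bar R,
      (forall x, polyh a b x -> (0 <= u x)%E) ->
      convex_on (polyh a b) u ->
      (poweR (vol_int a b cmu (fun x => poweR (u x) q)) q^-1
        <= C%:E * bdry_int a b csig o M u)%E.
Proof.
move=> arep cmu0 csig0 oMp q0 qd.
have [D [D0 HD]] := lebint_pow_le oMp arep q0 qd csig0.
(* Chosen so that the [q]-th root of [cmu * D] times the [q]-th power of [S] is [C * S]. *)
pose C := (cmu * D) `^ q^-1.
have C0 : 0 < C by rewrite powR_gt0// mulr_gt0.
exists C; split => // u u0 uc.
pose G i := lebint (fun y => (u \_ (face_i a b i)) (o i + y *m M i)).
have G0 i : (0 <= G i)%E.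
  apply: lebint_ge0 => y; rewrite /patch; case: ifP => //.
  by rewrite inE => -[/u0].
have SG i : ((csig i)%:E * G i <= bdry_int a b csig o M u)%E.
  rewrite /bdry_int (bigD1 i)//= leeDl// sume_ge0// => j _.
  by apply: mule_ge0; [rewrite lee_fin ltW|exact: G0].
have wG i : (lebint (facet_fun a b o M u i) <= G i)%E.
  apply: le_lebint => y; first exact: facet_fun_ge0.
  exact: facet_fun_le.
have S0 : (0 <= bdry_int a b csig o M u)%E.
  by apply: sume_ge0 => j _; apply: mule_ge0; [rewrite lee_fin ltW|exact: G0].
(* An infinite boundary integral makes the inequality trivial; a finite one bounds the integral over
   every facet. *)
move: S0 SG; case: (bdry_int a b csig o M u) => [S||] S0 SG //; last first.
  by rewrite gt0_muley ?lte_fin// leey.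
rewrite lee_fin in S0.
have Gfin i : (G i <= (S / csig i)%:E)%E.
  by rewrite mulrC EFinM lee_pdivlMl// SG.
have fl i : nlsc (facet_fun a b o M u i).
  have [//|woo] := facet_fun_dichotomy oMp u0 uc i.
  by have := le_trans (wG i) (Gfin i); rewrite woo leye_eq.
(* [S] may be 0, while the volume estimate asks for a positive bound: it is applied to [S + e / C],
   at a total cost of [e]. *)
rewrite -EFinM; apply/lee_addgt0Pr => e e0.
pose S' := S + e / C.
have S'0 : 0 < S' by rewrite ltr_wpDl// divr_gt0.
have wS' i : (lebint (facet_fun a b o M u i) <= (S' / csig i)%:E)%E.
  apply: le_trans (le_trans (wG i) (Gfin i)) _; rewrite lee_fin.
  by rewrite ler_pM2r ?invr_gt0// lerDl divr_ge0 ?ltW.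
have le_D := HD u S' u0 uc fl S'0 wS'.
have L0 : (0 <= lebint ((fun x => poweR (u x) q) \_ (polyh a b)))%E.
  by apply: lebint_ge0 => x; rewrite /patch; case: ifP => // _; exact: poweR_ge0.
have vol_le : (vol_int a b cmu (fun x => poweR (u x) q) <=
    (cmu * D * S' `^ q)%:E)%E.
  by rewrite /vol_int -mulrA EFinM lee_wpmul2l// lee_fin ltW.
apply: (@le_trans _ _ (poweR (cmu * D * S' `^ q)%:E q^-1)).
  apply: gt0_ler_poweR => //; first by rewrite invr_ge0 ltW.
    by rewrite in_itv/= leey andbT /vol_int mule_ge0// lee_fin ltW.
  by rewrite in_itv/= leey andbT lee_fin !mulr_ge0 ?powR_ge0// ltW.
have E : (cmu * D * S' `^ q) `^ q^-1 = C * S'.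
  rewrite powRM; [|by rewrite mulr_ge0// ltW|exact: powR_ge0].
  by rewrite -powRrM divff ?gt_eqF// powRr1// ltW.
rewrite poweR_EFin E -EFinD lee_fin /S' mulrDr.
by rewrite [C * (e / C)]mulrC divfK ?gt_eqF.
Qed.

Unset Implicit Arguments.

Theorem mainTheorem8 (R : realType) (n m : nat)
  (a : 'I_m -> 'rV[R]_n) (b : 'I_m -> R)
  (cmu : R) (csig : 'I_m -> R)
  (o : 'I_m -> 'rV[R]_n) (M : 'I_m -> 'M[R]_(n.-1, n)) :
  (2 <= n)%N ->
  simple_polytope_rep a b ->
  0 < cmu ->
  (forall i, 0 < csig i) ->
  (forall i, hyperplane_param (a i) (b i) (o i) (M i)) ->
  forall q : R, 1 <= q <= n%:R / (n%:R - 1) ->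
  exists C : R, 0 < C /\
    forall u : 'rV[R]_n -> \bar R,
      (forall x, polyh a b x -> (0 <= u x)%E) ->
      convex_on (polyh a b) u ->
      (poweR (vol_int a b cmu (fun x => poweR (u x) q)) q^-1
        <= C%:E * bdry_int a b csig o M u)%E.
Proof.
case: n a b o M => [|[|d]] a b o M // _ arep cmu0 csig0 oMp q /andP[q1 q2].
apply: lebint_bound_boundary => //; first exact: lt_le_trans ltr01 q1.
(* The dimension is [d.+2], so the denominator [n - 1] is the positive number [d.+1], and clearing
   it gives the bound on [q] in product form. *)
move: q2; rewrite -[X in _ / (X - 1)]natr1 addrK ler_pdivlMr ?ltr0n//.
by rewrite mulrC.
Qed.
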